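(* Let $T\in\mathcal{B}(l^2(\mathbb{N}))$ be an invertible operator (not necessarily normal) and suppose that there exists an orthogonal projection $P$ of finite rank $M$ such that the range of $P$ is invariant under $T$. Suppose also that there exist $\alpha>\beta>0$ such that $\|Tx\|\ge\alpha\|x\|$ for all $x\in\mathrm{ran}(P)$ and $\|(I-P)T(I-P)\|\le\beta$. Under these conditions there exists a canonical $M$-dimensional $T^*$-invariant subspace $S$ (defined in the context); in the special case that $\mathrm{ran}(I-P)$ is also $T$-invariant, $S=\mathrm{ran}(P)$. Let $\tilde P$ denote the orthogonal projection onto $S$ and suppose also that $\{\tilde Pe_j\}_{j=1}^M$ are linearly independent. Let $\{Q_n\}_{n\in\mathbb{N}}$ and $\{R_n\}_{n\in\mathbb{N}}$ be $Q$- and $R$-sequences of $T$ with respect to $\{e_i\}_{i\in\mathbb{N}}$. Then: (i) The subspace angle satisfies $\phi(\mathrm{span}\{e_j\}_{j=1}^M,S)<\pi/2$ and $$\hat\delta(\mathrm{span}\{Q_ne_j\}_{j=1}^M,\mathrm{ran}(P))\le\frac{\sin\big(\phi(\mathrm{span}\{e_j\}_{j=1}^M,\mathrm{ran}(P))\big)}{\cos\big(\phi(\mathrm{span}\{e_j\}_{j=1}^M,S)\big)}\,\frac{\beta^n}{\alpha^n}\Big(1+\frac{\|PT(I-P)\|}{\alpha-\beta}\Big).$$ (ii) Every subsequence of $\{Q_n^*TQ_n\}_{n\in\mathbb{N}}$ has a convergent subsequence $\{Q_{n_k}^*TQ_{n_k}\}_{k\in\mathbb{N}}$ such that, in the weak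 operator topology, $$Q_{n_k}^*TQ_{n_k}\longrightarrow\sum_{j=1}^M\xi_j\otimes e_j+\sum_{i=M+1}^\infty\zeta_i\otimes e_i,\qquad k\to\infty,$$ where $\xi_j\in\mathrm{span}\{e_l\}_{l=1}^M$ and $\zeta_i\in l^2(\mathbb{N})$. Furthermore, if $T$ has only finitely many non-zero entries in each column, then weak operator convergence can be replaced by strong operator convergence.
   Context: $\{e_j\}_{j\in\mathbb{N}}$ is the canonical orthonormal basis of $l^2(\mathbb{N})$; inner products are linear in the first argument; $T$ is identified with the infinite matrix with entries $\langle Te_j,e_i\rangle$. For $u,v\in l^2(\mathbb{N})$, $u\otimes v$ denotes the operator $x\mapsto\langle x,v\rangle u$. The subspace $S$: with respect to $l^2(\mathbb{N})=\mathrm{ran}(P)\oplus\mathrm{ran}(I-P)$ write $T=\begin{pmatrix}T_{11}&T_{12}\\0&T_{22}\end{pmatrix}$, so $T_{11}=T|_{\mathrm{ran}(P)}$ (invertible on $\mathrm{ran}(P)$ with $\|T_{11}^{-1}\|\le1/\alpha$), $T_{12}=PT|_{\mathrm{ran}(I-P)}$, $T_{22}=(I-P)T|_{\mathrm{ran}(I-P)}$. Let $A:\mathrm{ran}(I-P)\to\mathrm{ran}(P)$ be the bounded operator determined by $A-T_{11}^{-1}AT_{22}=-T_{11}^{-1}T_{12}$, i.e. $A=\sum_{k\ge0}T_{11}^{-k}(-T_{11}^{-1}T_{12})T_{22}^k$. Then $S=\{x-A^*x:x\in\mathrm{ran}(P)\}$. $Q$- and $R$-sequences (IQR algorithm): an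 operator $R$ is upper triangular if $\langle Re_j,e_i\rangle=0$ for $i>j$. For invertible $T$, put $T_0=T$ and recursively take a QR decomposition $T_{m-1}=Q^{(m)}R^{(m)}$ ($Q^{(m)}$ unitary, $R^{(m)}$ upper triangular) and set $T_m=R^{(m)}Q^{(m)}$. Put $Q_n=Q^{(1)}\cdots Q^{(n)}$ and $R_n=R^{(n)}\cdots R^{(1)}$. Then $\{Q_n\}$ and $\{R_n\}$ are called a $Q$-sequence and an $R$-sequence of $T$; $T_n=Q_n^*TQ_n$ and $T^n=Q_nR_n$. For closed subspaces $M_1,M_2$ of $l^2(\mathbb{N})$ with orthogonal projections $E,F$, $\hat\delta(M_1,M_2)=\|E-F\|$, and the (maximal) subspace angle $\phi(M_1,M_2)\in[0,\pi/2]$ is defined by $\sin(\phi(M_1,M_2))=\hat\delta(M_1,M_2)$. *)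

(* Defs.v *)
From HB Require Import structures.
From mathcomp Require Import all_boot all_order all_algebra complex.
From mathcomp Require Import ring lra.
From mathcomp Require Import all_classical all_reals all_analysis.

Set Implicit Arguments.
Unset Strict Implicit.
Unset Printing Implicit Defensive.

Import Order.TTheory GRing.Theory Num.Theory numFieldNormedType.Exports.
Import Normc.

Local Open Scope classical_set_scope.
Local Open Scope ring_scope.

Section SquareSummable.
Variable R : realType.
Implicit Types x y : nat -> R[i].

Definition square_summable x : Prop :=
  cvgn (series (fun k => normc (x k) ^+ 2)).

Definition ell2 : {pred nat -> R[i]} := fun x => `[< square_summable x >].

Lemma sqr_normcE (z : R[i]) :
  normc z ^+ 2 = complex.Re z ^+ 2 + complex.Im z ^+ 2.
Proof. by case: z => a b /=; rewrite sqr_sqrtr// addr_ge0 ?sqr_ge0. Qed.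

Lemma sqr_normc_linear (a u v : R[i]) :
  normc (a * u + v) ^+ 2 <=
  2 * (normc a ^+ 2 * normc u ^+ 2) + 2 * normc v ^+ 2.
Proof.
rewrite !sqr_normcE; case: a u v => [a b] [c d] [e f] /=.
set p := a * c - b * d; set q := a * d + b * c.
have -> : (a ^+ 2 + b ^+ 2) * (c ^+ 2 + d ^+ 2) = p ^+ 2 + q ^+ 2.
  by rewrite /p /q; ring.
have -> : 2 * (p ^+ 2 + q ^+ 2) + 2 * (e ^+ 2 + f ^+ 2) =
  (p + e) ^+ 2 + (q + f) ^+ 2 + ((p - e) ^+ 2 + (q - f) ^+ 2) by ring.
by rewrite lerDl addr_ge0 ?sqr_ge0.
Qed.

Lemma ell2_submod_closed : submod_closed ell2.
Proof.
split.
  apply/asboolP; rewrite /square_summable.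
  rewrite (_ : series _ = cst 0); first exact: is_cvg_cst.
  apply/funext => n; rewrite /series /= big1// => k _.
  by rewrite /= expr0n /= addr0 sqrtr0 expr0n.
move=> a x y /asboolP xs /asboolP ys; apply/asboolP.
apply: (@series_le_cvg _ _ (fun k =>
  (2 * normc a ^+ 2) *: normc (x k) ^+ 2 + 2 *: normc (y k) ^+ 2)).
- by move=> k; exact: sqr_ge0.
- move=> k; apply: addr_ge0; (apply: mulr_ge0; [|exact: sqr_ge0]) => //.
  by apply: mulr_ge0 => //; exact: sqr_ge0.
- move=> k; rewrite (le_trans (sqr_normc_linear _ _ _))//.
  by rewrite /GRing.scale /= mulrA.
- by apply: is_cvg_seriesD; apply: is_cvg_seriesZ.
Qed.

HB.instance Definition _ :=
  GRing.isSubmodClosed.Build R[i] (nat -> R[i]) ell2 ell2_submod_closed.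

End SquareSummable.

(* The complex Hilbert space l^2(N); coordinates are numbered from 0. *)
Record l2 (R : realType) := L2 {
  l2val :> nat -> R[i];
  l2valP : l2val \in @ell2 R
}.

HB.instance Definition _ (R : realType) := [isSub for @l2val R].
HB.instance Definition _ (R : realType) := [Choice of l2 R by <:].
HB.instance Definition _ (R : realType) :=
  [SubChoice_isSubLmodule of l2 R by <:].

Section InnerProduct.
Variable R : realType.
Implicit Types x y z : l2 R.

(* The series of x_k * conj y_k, summed separately on real and imaginary
   parts; it converges absolutely, see is_cvg_re_term and is_cvg_im_term. *)
Definition re_term x y (k : nat) : R := complex.Re (x k * (y k)^*).
Definition im_term x y (k : nat) : R := complex.Im (x k * (y k)^*).
Definition dot x y : R[i] :=
  Complex (limn (series (re_term x y))) (limn (series (im_term x y))).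

Lemma l2_summable x : square_summable x.
Proof. by apply/asboolP; case: x. Qed.

Lemma is_cvg_re_im (t : R ^nat) x y :
  (forall k, `|t k| <= normc (x k) ^+ 2 + normc (y k) ^+ 2) ->
  cvgn (series t).
Proof.
move=> tle; apply: normed_cvg.
apply: (@series_le_cvg _ _ (fun k => normc (x k) ^+ 2 + normc (y k) ^+ 2)).
- by move=> k; exact: normr_ge0.
- by move=> k; apply: addr_ge0; exact: sqr_ge0.
- exact: tle.
- by apply: is_cvg_seriesD; exact: l2_summable.
Qed.

Lemma norm_add_mul_le (a b c d : R) :
  `|a * b + c * d| <= a ^+ 2 + c ^+ 2 + (b ^+ 2 + d ^+ 2).
Proof.
have := (sqr_ge0 a, sqr_ge0 b, sqr_ge0 c, sqr_ge0 d).
have := (sqr_ge0 (a + b), sqr_ge0 (a - b), sqr_ge0 (c + d), sqr_ge0 (c - d)).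
rewrite ler_norml => -[[[h1 h2] h3] h4] [[[h5 h6] h7] h8].
by apply/andP; split; nra.
Qed.

Lemma is_cvg_re_term x y : cvgn (series (re_term x y)).
Proof.
apply: (@is_cvg_re_im _ x y) => k; rewrite /re_term !sqr_normcE.
case: (x k) (y k) => [a b] [c d] /=.
by have := norm_add_mul_le a c b d; rewrite mulrN opprK.
Qed.

Lemma is_cvg_im_term x y : cvgn (series (im_term x y)).
Proof.
apply: (@is_cvg_re_im _ x y) => k; rewrite /im_term !sqr_normcE.
case: (x k) (y k) => [a b] [c d] /=.
by have := norm_add_mul_le a (- d) b c; rewrite sqrrN [d ^+ 2 + _]addrC.
Qed.

Lemma dot_herm x y : dot x y = (-1) ^+ false * (dot y x)^*.
Proof.
rewrite expr0 mul1r; apply/eqP; rewrite eq_complex /=; apply/andP; split.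
  apply/eqP; congr (limn (series _)); apply/funext => k; rewrite /re_term.
  by case: (x k) (y k) => [a b] [c d] /=; ring.
apply/eqP; rewrite -lim_seriesN; last exact: is_cvg_im_term.
congr (limn (series _)); apply/funext => k; rewrite /im_term.
by rewrite /GRing.opp /=; case: (x k) (y k) => [a b] [c d] /=; ring.
Qed.

Lemma l2_linearE (a : R[i]) x y k : (a *: x + y) k = a * x k + y k.
Proof. by []. Qed.

Lemma lim_series_lin3 (a b : R) (f g h : R ^nat) :
  cvgn (series f) -> cvgn (series g) -> cvgn (series h) ->
  limn (series (a *: f + b *: g + h)) =
  a * limn (series f) + b * limn (series g) + limn (series h).
Proof.
move=> cf cg ch; have caf := @is_cvg_seriesZ _ _ a cf.
have cbg := @is_cvg_seriesZ _ _ b cg.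
rewrite (lim_seriesD (is_cvg_seriesD caf cbg) ch) (lim_seriesD caf cbg).
by rewrite (lim_seriesZ a cf) (lim_seriesZ b cg).
Qed.

Lemma dot_linearl z : linear_for *%R (dot ^~ z).
Proof.
move=> a x y; have cr := is_cvg_re_term; have ci := is_cvg_im_term.
apply/eqP; rewrite eq_complex; case: a => a b /=; apply/andP; split; apply/eqP.
  rewrite -mulNr -lim_series_lin3//; congr (limn (series _)); apply/funext => k.
  rewrite [LHS]/re_term l2_linearE !fctE /re_term /im_term.
  by case: (x k) (y k) (z k) => [? ?] [? ?] [? ?]; rewrite /= /GRing.scale /=; ring.
rewrite -lim_series_lin3//; congr (limn (series _)); apply/funext => k.
rewrite [LHS]/im_term l2_linearE !fctE /re_term /im_term.
by case: (x k) (y k) (z k) => [? ?] [? ?] [? ?]; rewrite /= /GRing.scale /=; ring.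
Qed.

Lemma dot_linearr x : linear_for (Num.conj \; *%R) (dot x).
Proof.
move=> a y z; rewrite dot_herm expr0 mul1r dot_linearl rmorphD rmorphM /=.
by rewrite [dot x y]dot_herm [dot x z]dot_herm !expr0 !mul1r.
Qed.

Lemma dot_gt0 x : x != 0 -> 0 < dot x x.
Proof.
move=> x0; have [k xk0] : exists k, x k != 0.
  apply: contra_neqP x0 => /forallNP xE; apply: val_inj; apply/funext => k.
  by apply/eqP/negPn/negP; exact: xE.
have reE : re_term x x = (fun i => normc (x i) ^+ 2).
  apply/funext => i; rewrite /re_term sqr_normcE.
  by case: (x i) => a b /=; ring.
have imE : im_term x x = cst 0.
  by apply/funext => i; rewrite /im_term; case: (x i) => a b /=; ring.
rewrite ltcE /= imE (_ : series (cst 0) = cst 0); last first.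
  by apply/funext => n; rewrite /series /= big1.
rewrite lim_cst// eqxx /= reE.
apply: (@lt_le_trans _ _ (series (fun i => normc (x i) ^+ 2) k.+1)).
  rewrite /series /= big_nat_recr//=; apply: ltr_wpDl.
    by apply: sumr_ge0 => i _; exact: sqr_ge0.
  rewrite lt_neqAle sqr_ge0 andbT eq_sym sqrf_eq0.
  by apply: contra_neq xk0; exact: eq0_normc.
apply: nondecreasing_cvgn_le; last exact: l2_summable.
by apply: nondecreasing_series => i _ _; exact: sqr_ge0.
Qed.

HB.instance Definition _ := bilinear_isBilinear.Build R[i] (l2 R) (l2 R) R[i]
  *%R (Num.conj \; *%R) dot (dot_linearl, dot_linearr).
HB.instance Definition _ := isHermitianSesquilinear.Build R[i] (l2 R) false
  Num.conj dot dot_herm.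
HB.instance Definition _ := isDotProduct.Build R[i] (l2 R) dot dot_gt0.

Definition l2norm x : R := Num.sqrt (complex.Re (dot x x)).

Lemma delta_ell2 (j : nat) : (fun k => (k == j)%:R : R[i]) \in @ell2 R.
Proof.
apply/asboolP/cvg_ex; exists 1; apply: cvg_near_cst; exists j.+1 => //= n /= jn.
rewrite /series /= (bigD1_seq j) ?iota_uniq ?mem_index_iota//= big1.
  by rewrite eqxx addr0 sqr_normcE /= expr1n expr0n addr0.
by move=> k /negPf ->; rewrite sqr_normcE /= expr0n addr0.
Qed.

Definition e_ (j : nat) : l2 R := L2 (delta_ell2 j).

End InnerProduct.

Arguments e_ {R} j.

Section Operators.
Variable R : realType.
Local Notation H := (l2 R).
Implicit Types (T P E Q U A B L : H -> H) (V W S : set H).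

Definition bounded_op T : Prop :=
  linear T /\ exists C : R, forall x, l2norm (T x) <= C * l2norm x.

Definition opnorm T : R :=
  sup [set l2norm (T x) | x in [set x | l2norm x <= 1]].

Definition invertible_op T : Prop :=
  exists B, [/\ bounded_op B, B \o T = idfun & T \o B = idfun].

(* The Hilbert adjoint of a bounded operator, 0 on other maps. *)
Definition adjoint T : H -> H :=
  xget 0 [set B | bounded_op B /\ forall x y, dot (T x) y = dot x (B y)].

Definition rank_one (u v : H) : H -> H := fun x => dot x v *: u.

Definition family_span n (v : 'I_n -> H) : set H :=
  range (fun c : 'I_n -> R[i] => \sum_(i < n) c i *: v i).

Definition lin_indep n (v : 'I_n -> H) : Prop :=
  forall c : 'I_n -> R[i], \sum_(i < n) c i *: v i = 0 -> forall i, c i = 0.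

Definition has_dim V n : Prop :=
  exists v : 'I_n -> H, lin_indep v /\ family_span v = V.

Definition op_invariant T V : Prop := T @` V `<=` V.

Definition is_orthproj P : Prop :=
  [/\ bounded_op P, P \o P = P & adjoint P = P].

(* The orthogonal projection onto V, meaningful for a closed subspace V. *)
Definition orthproj V : H -> H :=
  xget 0 [set E | is_orthproj E /\ range E = V].

Definition gap V W : R := opnorm (orthproj V - orthproj W).

(* The angle phi in [0, pi/2] with sin phi = gap V W, as 0 <= gap V W <= 1. *)
Definition subspace_angle V W : R := asin (gap V W).

Definition unitary_op Q : Prop :=
  [/\ bounded_op Q, adjoint Q \o Q = idfun & Q \o adjoint Q = idfun].

Definition upper_triangular U : Prop :=
  forall i j : nat, (j < i)%N -> dot (U (e_ j)) (e_ i) = 0.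

Definition qr_decomposition T Q U : Prop :=
  [/\ unitary_op Q, bounded_op U, upper_triangular U & T = Q \o U].

(* q m and r m stand for Q^(m) and R^(m), m >= 1; q 0 and r 0 are not used. *)
Definition QR_sequences T (Qs Rs : nat -> H -> H) : Prop :=
  exists Ts q r : nat -> H -> H,
    [/\ Ts 0 = T,
        forall m, qr_decomposition (Ts m) (q m.+1) (r m.+1) /\
                  Ts m.+1 = r m.+1 \o q m.+1,
        Qs 0 = idfun /\ (forall n, Qs n.+1 = Qs n \o q n.+1) &
        Rs 0 = idfun /\ (forall n, Rs n.+1 = r n.+1 \o Rs n)].

(* B restricts to the inverse of T_11 = T|ran(P) : ran(P) -> ran(P). *)
Definition inverse_on_range P T B : Prop :=
  forall x, range P x -> [/\ range P (B x), B (T x) = x & T (B x) = x].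

(* A is the bounded solution of A - T_11^-1 A T_22 = - T_11^-1 T_12 on
   ran(I - P), extended by 0 on ran(P) to an operator on the whole space. *)
Definition coupling_op P T A : Prop :=
  [/\ bounded_op A, A \o P = 0, P \o A = A &
      exists2 B, inverse_on_range P T B &
        forall y, range (idfun - P) y ->
          A y - B (A (T y - P (T y))) = - B (P (T y))].

Definition coupling_space P A : set H :=
  [set x - adjoint A x | x in range P].

Definition sot_cvg (Ts : nat -> H -> H) L : Prop :=
  forall x, l2norm (Ts n x - L x) @[n --> \oo] --> (0 : R).

Definition wot_cvg (Ts : nat -> H -> H) L : Prop :=
  forall x y, normc (dot (Ts n x) y - dot (L x) y) @[n --> \oo] --> (0 : R).

Definition finite_columns T : Prop :=
  forall j : nat, finite_set [set i : nat | dot (T (e_ j)) (e_ i) != 0].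

(* The infinite sum of rank-one operators is read as a strong limit. *)
Definition block_form M L : Prop :=
  bounded_op L /\
  exists (xi : 'I_M -> H) (zeta : nat -> H),
    (forall j, family_span (fun l : 'I_M => e_ l) (xi j)) /\
    sot_cvg (fun n => \sum_(j < M) rank_one (xi j) (e_ j)
                      + \sum_(M <= i < n) rank_one (zeta i) (e_ i)) L.

End Operators.

(* Main.v *)
(* Let A be the coupling operator. The map Z = P - A onto
   ran(P) commutes with T, and its adjoint has range S, so S is T^*-invariant and
   Z vanishes on the orthogonal complement of S. Since T^n = Q_n R_n with R_n
   upper triangular and injective, the span of the first M columns of Q_n is T^n
   applied to span(e_1, ..., e_M). For y in the latter span,
     |(I - P) T^n y| <= beta^n |(I - P) y| <= beta^n sin(phi) |y|,
     cos(phi_S) |y| <= |P_S y| <= |Z y| <= alpha^-n |T^n Z y|,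
     |T^n Z y| = |Z T^n y| <= (1 + |A|) |T^n y|,
   and |A| <= |P T (I - P)| / (alpha - beta). As both subspaces have dimension M,
   the one-sided distance bound is a bound on the gap. The gap tends to 0, which
   kills the lower left block of any weak limit of Q_n^* T Q_n; weak limits along
   subsequences exist by a diagonal argument on the matrix entries. When T has
   finite columns, Q_n^* T Q_n = R_n T R_n^-1 has columns supported in a set
   independent of n, so that entrywise convergence is strong convergence. *)

Require Import Defs.
From mathcomp Require Import all_boot all_order all_algebra complex.
From mathcomp Require Import ring lra.
From mathcomp Require Import all_classical all_reals all_analysis.

Set Implicit Arguments.
Unset Strict Implicit.
Unset Printing Implicit Defensive.

Import Order.TTheory GRing.Theory Num.Theory numFieldNormedType.Exports.
Import Normc.

Local Open Scope classical_set_scope.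
Local Open Scope ring_scope.

(** * Norm and inner product *)

(** [Z] is the oblique projection onto ran(P) along the orthogonal complement of S, which is a
    T-invariant complement of ran(P). The component of a starting vector that T^n expands by at
    least alpha^n is the one cut out by this oblique projection; hence the denominator is the cosine
    of the angle with S, not with ran(P), and the factor 1 + |A| is the price of obliqueness. Limits
    of operators are obtained in one way only, from weak operator compactness of bounded sequences.
    The coupling operator is a weak cluster point of the partial sums of its Neumann series, then
    identified as a fixed point; the limits in (ii) come from the same compactness lemma. Finite
    dimension enters through one count: an injective linear map between spaces of equal finite
    dimension is onto. It makes the inverse of T preserve ran(P), makes R_n invertible on every
    initial span, and turns a one-sided distance into a gap with the same constant. *)

Section ComplexNorm.
Variable R : realType.
Implicit Types (z w : R[i]).

Lemma normcC z : (normc z)%:C%C = `|z|.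
Proof. by []. Qed.

Lemma normc_ge0 z : 0 <= normc z.
Proof. by rewrite -lecR normcC normr_ge0. Qed.

Lemma normc_real (a : R) : 0 <= a -> normc (a%:C)%C = a.
Proof.
by move=> a0; apply: complexI; rewrite normcC ger0_norm// lecE /= eqxx.
Qed.

Lemma normcB z w : normc (z - w) = normc (w - z).
Proof. by rewrite -opprB normcN. Qed.

Lemma normc_conj z : normc (z^*) = normc z.
Proof.
by apply: (@complexI R); rewrite !normcC norm_conjC.
Qed.

Lemma Re_le_normc z : complex.Re z <= normc z.
Proof.
apply: le_trans (ler_norm _) _.
by rewrite -lecR normcC normc_ge_Re.
Qed.

Lemma normc_sum (I : Type) (r : seq I) (p : pred I) (F : I -> R[i]) :
  normc (\sum_(i <- r | p i) F i) <= \sum_(i <- r | p i) normc (F i).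
Proof.
rewrite -lecR rmorph_sum /= normcC; exact: ler_norm_sum.
Qed.

Lemma sqr_normcC z : ((normc z) ^+ 2)%:C%C = z * z^*.
Proof. by rewrite rmorphXn /= normcC normCK. Qed.

End ComplexNorm.

Section Norm.
Variable R : realType.
Implicit Types (x y z : l2 R) (a : R[i]).

Lemma dotDl x y z : dot (x + y) z = dot x z + dot y z.
Proof. exact: linearDl. Qed.
Lemma dotDr x y z : dot x (y + z) = dot x y + dot x z.
Proof. exact: linearDr. Qed.
Lemma dotBl x y z : dot (x - y) z = dot x z - dot y z.
Proof. exact: linearBl. Qed.
Lemma dotBr x y z : dot x (y - z) = dot x y - dot x z.
Proof. exact: linearBr. Qed.
Lemma dot0l x : dot 0 x = 0.
Proof. exact: linear0l. Qed.
Lemma dot0r x : dot x 0 = 0.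
Proof. exact: linear0r. Qed.
Lemma dotZl a x y : dot (a *: x) y = a * dot x y.
Proof. exact: linearZl_LR. Qed.
Lemma dotZr a x y : dot x (a *: y) = a^* * dot x y.
Proof. exact: linearZr_LR. Qed.
Lemma dot_suml (I : Type) (r : seq I) (p : pred I) (F : I -> l2 R) y :
  dot (\sum_(i <- r | p i) F i) y = \sum_(i <- r | p i) dot (F i) y.
Proof. exact: linear_sumlz. Qed.
Lemma dot_sumr (I : Type) (r : seq I) (p : pred I) (F : I -> l2 R) y :
  dot y (\sum_(i <- r | p i) F i) = \sum_(i <- r | p i) dot y (F i).
Proof. exact: linear_sumr. Qed.
Lemma dotC x y : dot x y = (dot y x)^*.
Proof. by rewrite dot_herm expr0 mul1r. Qed.

Lemma dot_eq0C x y : dot x y = 0 -> dot y x = 0.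
Proof. by move=> h; rewrite dotC h rmorph0. Qed.

Lemma dot_ge0 x : 0 <= dot x x.
Proof. have [->|/dot_gt0/ltW//] := eqVneq x 0; by rewrite dot0l. Qed.

Lemma l2norm_ge0 x : 0 <= l2norm x.
Proof. exact: sqrtr_ge0. Qed.

Lemma dot_sqr x : dot x x = ((l2norm x) ^+ 2)%:C%C.
Proof.
have := dot_ge0 x; rewrite lecE /= => /andP[/eqP h1 h2].
rewrite /l2norm sqr_sqrtr//.
by apply/eqP; rewrite eq_complex /= h1 !eqxx.
Qed.

Lemma l2norm_sqr x : l2norm x ^+ 2 = complex.Re (dot x x).
Proof. by rewrite dot_sqr. Qed.

Lemma dot_eq0 x : dot x x = 0 -> x = 0.
Proof.
by move=> h; have [//|/dot_gt0] := eqVneq x 0; rewrite h ltxx.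
Qed.

Lemma l2norm_eq0 x : l2norm x = 0 -> x = 0.
Proof. by move=> h; apply: dot_eq0; rewrite dot_sqr h expr0n. Qed.

Lemma l2norm_gt0 x : x != 0 -> 0 < l2norm x.
Proof.
move=> x0; rewrite lt_neqAle l2norm_ge0 andbT.
by apply: contra_neq x0 => /esym/l2norm_eq0.
Qed.

Lemma l2norm0 : l2norm (0 : l2 R) = 0.
Proof. by rewrite /l2norm dot0l /= sqrtr0. Qed.

Lemma l2normZ a x : l2norm (a *: x) = normc a * l2norm x.
Proof.
apply/eqP; rewrite -(@eqrXn2 _ 2) ?mulr_ge0 ?normc_ge0 ?l2norm_ge0//; apply/eqP.
apply: (@complexI R); rewrite -dot_sqr dotZl dotZr mulrA -sqr_normcC dot_sqr.
by rewrite -rmorphM exprMn.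
Qed.

Lemma l2normN x : l2norm (- x) = l2norm x.
Proof. by rewrite -scaleN1r l2normZ normcN normc1 mul1r. Qed.

Lemma l2normB x y : l2norm (x - y) = l2norm (y - x).
Proof. by rewrite -opprB l2normN. Qed.

Lemma pythagoras x y : dot x y = 0 ->
  l2norm (x + y) ^+ 2 = l2norm x ^+ 2 + l2norm y ^+ 2.
Proof.
move=> xy; apply: complexI; rewrite rmorphD /= -!dot_sqr dotDl !dotDr.
by rewrite xy (dot_eq0C xy) addr0 add0r.
Qed.

Lemma cauchy_schwarz x y : normc (dot x y) <= l2norm x * l2norm y.
Proof.
have [->|y0] := eqVneq y 0; first by rewrite dot0r normc0 l2norm0 mulr0.
have ny := l2norm_gt0 y0.
(* [a *: y] is the orthogonal projection of x onto the line of y; by Pythagoras it is no longer than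
   x, which is the inequality after clearing denominators. *)
pose a := dot x y / dot y y.
have dyy : dot y y != 0 by apply: contra_neq y0; exact: dot_eq0.
have o : dot (x - a *: y) (a *: y) = 0.
  by rewrite dotZr dotBl dotZl divfK// subrr mulr0.
have := pythagoras o; rewrite subrK => px.
have : l2norm (a *: y) <= l2norm x.
  rewrite -(@ler_pXn2r _ 2) ?nnegrE ?l2norm_ge0// px lerDr.
  by rewrite sqr_ge0.
rewrite l2normZ normcM normcV dot_sqr.
rewrite (normc_real (sqr_ge0 _)).
rewrite -mulrA expr2 invfM -mulrA mulVf ?gt_eqF// mulr1.
by rewrite ler_pdivrMr.
Qed.

Lemma l2normD x y : l2norm (x + y) <= l2norm x + l2norm y.
Proof.
rewrite -(@ler_pXn2r _ 2) ?nnegrE ?addr_ge0 ?l2norm_ge0//.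
have -> : l2norm (x + y) ^+ 2 = l2norm x ^+ 2 + complex.Re (dot x y) +
    (complex.Re (dot y x) + l2norm y ^+ 2).
  rewrite !l2norm_sqr dotDl !dotDr.
  by case: (dot x x) (dot x y) (dot y x) (dot y y) => [? ?] [? ?] [? ?] [? ?].
have h1 := le_trans (Re_le_normc _) (cauchy_schwarz x y).
have h2 := le_trans (Re_le_normc _) (cauchy_schwarz y x).
nra.
Qed.

Lemma l2norm_tri x y : l2norm x <= l2norm y + l2norm (x - y).
Proof. by rewrite -{1}(subrK y x) addrC l2normD. Qed.

Lemma l2norm_sum (I : Type) (r : seq I) (p : pred I) (F : I -> l2 R) :
  l2norm (\sum_(i <- r | p i) F i) <= \sum_(i <- r | p i) l2norm (F i).
Proof.
elim/big_ind2 : _ => [|x1 a1 x2 a2 h1 h2|//]; first by rewrite l2norm0.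
by apply: le_trans (l2normD _ _) _; exact: lerD.
Qed.

End Norm.

Section LinearMaps.
Variables (R : realType) (T : l2 R -> l2 R).
Hypothesis linT : linear T.

Lemma linD x y : T (x + y) = T x + T y.
Proof. by rewrite -[x]scale1r linT !scale1r. Qed.
Lemma lin0 : T 0 = 0.
Proof. by apply: (addrI (T 0)); rewrite -linD !addr0. Qed.
Lemma linZ a x : T (a *: x) = a *: T x.
Proof. by rewrite -[a *: x]addr0 linT lin0 addr0. Qed.
Lemma linN x : T (- x) = - T x.
Proof. by rewrite -scaleN1r linZ scaleN1r. Qed.
Lemma linB x y : T (x - y) = T x - T y.
Proof. by rewrite linD linN. Qed.
Lemma lin_sum (I : Type) (r : seq I) (p : pred I) (F : I -> l2 R) :
  T (\sum_(i <- r | p i) F i) = \sum_(i <- r | p i) T (F i).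
Proof. exact: (big_morph T linD lin0). Qed.

End LinearMaps.

(** Closes density arguments, where a quantity is bounded by a fixed multiple of an arbitrary
    truncation error. *)
Lemma le0_eps (R : realType) (a K : R) : 0 <= K ->
  (forall e, 0 < e -> a <= K * e) -> a <= 0.
Proof.
move=> K0 h; rewrite leNgt; apply/negP => a0.
have K1 : 0 < K + 1 by lra.
have := h (a / (2 * (K + 1))); rewrite divr_gt0// ?mulr_gt0// => /(_ isT).
have -> : K * (a / (2 * (K + 1))) = (K / (K + 1)) * (a / 2).
  by field; lra.
have : K / (K + 1) <= 1 by rewrite ler_pdivrMr// mul1r; lra.
nra.
Qed.

(** * Coordinates, truncations, and vectors built from coordinates *)

Section Coordinates.
Variable R : realType.
Implicit Types (x y z : l2 R) (a : R[i]).

Lemma lim_series_single (t : nat -> R) k : (forall i, i != k -> t i = 0) ->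
  limn (series t) = t k.
Proof.
move=> h; apply: lim_near_cst => //; exists k.+1 => //= n /= kn.
rewrite /series /= (bigD1_seq k) ?iota_uniq ?mem_index_iota//= big1 ?addr0//.
Qed.

Lemma dot_e x k : dot x (e_ k) = x k.
Proof.
rewrite /dot !(@lim_series_single _ k); last 2 first.
- by move=> i /negPf ik; rewrite /im_term /= ik conjC0 mulr0.
- by move=> i /negPf ik; rewrite /re_term /= ik conjC0 mulr0.
by rewrite /re_term /im_term /= eqxx conjC1 mulr1; case: (x k).
Qed.

Lemma dot_ee j k : dot (e_ j : l2 R) (e_ k) = (k == j)%:R.
Proof. by rewrite dot_e. Qed.

Lemma l2norm_e j : l2norm (e_ j : l2 R) = 1.
Proof. by rewrite /l2norm dot_ee eqxx /= sqrtr1. Qed.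

Lemma l2_ext x y : (forall k, x k = y k) -> x = y.
Proof. by move=> h; apply: val_inj; apply/funext. Qed.

Lemma l2_dot_ext x y : (forall z, dot x z = dot y z) -> x = y.
Proof. by move=> h; apply: l2_ext => k; rewrite -!dot_e h. Qed.

Lemma l2BE x y k : (x - y) k = x k - y k.
Proof. by []. Qed.

Definition trunc n x : l2 R := \sum_(k < n) x k *: e_ k.

Lemma dot_comb_e n (c : nat -> R[i]) y :
  dot (\sum_(k < n) c k *: e_ k) y = \sum_(k < n) c k * (y k)^*.
Proof. by rewrite dot_suml; apply: eq_bigr => k _; rewrite dotZl dotC dot_e. Qed.

Lemma comb_e_coord n (c : nat -> R[i]) j :
  (\sum_(k < n) c k *: e_ k : l2 R) j = if (j < n)%N then c j else 0.
Proof.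
rewrite -dot_e dot_comb_e; case: ifPn => jn.
  rewrite (bigD1 (Ordinal jn)) //= eqxx conjC1 mulr1 big1 ?addr0// => i.
  by rewrite -val_eqE /= => /negPf ->; rewrite conjC0 mulr0.
rewrite big1// => i _; have /negPf ne : (i : nat) != j.
  by apply: contraNneq jn => <-.
by rewrite /= ne conjC0 mulr0.
Qed.

Lemma l2norm_comb_e n (c : nat -> R[i]) :
  l2norm (\sum_(k < n) c k *: e_ k : l2 R) ^+ 2 = \sum_(k < n) normc (c k) ^+ 2.
Proof.
apply: complexI; rewrite -dot_sqr dot_comb_e rmorph_sum /=.
by apply: eq_bigr => k _; rewrite comb_e_coord ltn_ord sqr_normcC.
Qed.

Lemma l2norm_trunc n x : l2norm (trunc n x) ^+ 2 = \sum_(k < n) normc (x k) ^+ 2.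
Proof. exact: l2norm_comb_e. Qed.

Lemma trunc_orth n x : dot (x - trunc n x) (trunc n x) = 0.
Proof.
rewrite dotC dot_comb_e big1 ?rmorph0// => k _.
by rewrite l2BE comb_e_coord ltn_ord subrr conjC0 mulr0.
Qed.

Lemma l2norm_trunc_split n x :
  l2norm x ^+ 2 = l2norm (x - trunc n x) ^+ 2 + l2norm (trunc n x) ^+ 2.
Proof. by rewrite -(pythagoras (trunc_orth n x)) subrK. Qed.

Lemma l2norm_trunc_le n x : l2norm (trunc n x) <= l2norm x.
Proof.
by rewrite -(@ler_pXn2r _ 2) ?nnegrE ?l2norm_ge0// (l2norm_trunc_split n x) lerDr
  sqr_ge0.
Qed.

Lemma l2norm_sqr_series x : l2norm x ^+ 2 = limn (series (fun k => normc (x k) ^+ 2)).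
Proof.
rewrite l2norm_sqr /=; congr (limn (series _)); apply/funext => k.
by rewrite /re_term -sqr_normcC.
Qed.

(** By Pythagoras the squared tail is the limit minus the n-th partial sum of the series of squared
    moduli. *)
Lemma trunc_cvg x e : 0 < e ->
  exists N, forall n, (N <= n)%N -> l2norm (x - trunc n x) <= e.
Proof.
move=> e0; have /cvgrPdist_le/(_ (e ^+ 2)) := @l2_summable _ x.
rewrite exprn_gt0// => /(_ isT)[N _ hN]; exists N => n Nn.
rewrite -(@ler_pXn2r _ 2) ?nnegrE ?l2norm_ge0 ?(ltW e0)//.
have := hN n Nn; rewrite -l2norm_sqr_series /series /= big_mkord -l2norm_trunc.
by rewrite (l2norm_trunc_split n x) addrK; apply: le_trans; exact: ler_norm.
Qed.

(** Monotone bounded partial sums converge. This plays the part of completeness: Riesz vectors and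
    weak limits are both produced here from their coordinates. *)
Lemma mk_l2 (a : nat -> R[i]) (C : R) : 0 <= C ->
  (forall n, \sum_(k < n) normc (a k) ^+ 2 <= C ^+ 2) ->
  exists z : l2 R, (forall k, z k = a k) /\ l2norm z <= C.
Proof.
move=> C0 h.
have nd : nondecreasing_seq (series (fun k => normc (a k) ^+ 2)).
  by apply: nondecreasing_series => i _ _; exact: sqr_ge0.
have hs n : series (fun k => normc (a k) ^+ 2) n <= C ^+ 2.
  by rewrite /series /= big_mkord.
have sa : square_summable a.
  apply: nondecreasing_is_cvgn => //.
  by exists (C ^+ 2) => _ [n _ <-].
have pa : a \in @ell2 R by apply/asboolP.
exists (L2 pa); split => //.
rewrite -(@ler_pXn2r _ 2) ?nnegrE ?l2norm_ge0//.
rewrite l2norm_sqr_series /=; apply: limr_le => //.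
by near=> n; exact: hs.
Unshelve. all: by end_near. Qed.

Lemma coord_le x k : normc (x k) <= l2norm x.
Proof.
by rewrite -dot_e; apply: le_trans (cauchy_schwarz _ _) _; rewrite l2norm_e mulr1.
Qed.

Lemma normc_le0 a : normc a <= 0 -> a = 0.
Proof. by move=> h; apply: eq0_normc; apply/eqP; rewrite eq_le h normc_ge0. Qed.

End Coordinates.

(** * Riesz representation and the adjoint *)

Section Adjoint.
Variable R : realType.
Implicit Types (x y z : l2 R) (T : l2 R -> l2 R).

Lemma bounded_opP T : bounded_op T ->
  linear T /\ exists2 C : R, 0 <= C & forall x, l2norm (T x) <= C * l2norm x.
Proof.
move=> [lT [C hC]]; split => //; exists `|C| => // x.
by apply: le_trans (hC x) _; rewrite ler_wpM2r ?l2norm_ge0// ler_norm.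
Qed.

(** Taking x = [e_ k] forces the coordinates of z. They are square summable by testing T on their
    own truncation, and the identity passes from finite combinations of basis vectors to all x by
    continuity. *)
Lemma riesz T (C : R) y : linear T -> 0 <= C ->
  (forall x, l2norm (T x) <= C * l2norm x) ->
  exists z, (forall x, dot (T x) y = dot x z) /\ l2norm z <= C * l2norm y.
Proof.
move=> lT C0 hC; pose a k := (dot (T (e_ k)) y)^*.
have Cy : 0 <= C * l2norm y by rewrite mulr_ge0// l2norm_ge0.
have [] := @mk_l2 R a (C * l2norm y) => //.
  (* With this w the pairing of T w with y equals |w|^2, so Cauchy-Schwarz gives |w|^2 <= C |w| |y|,
     and one factor |w| cancels. *)
  move=> n; pose w : l2 R := \sum_(k < n) a k *: e_ k.
  have nw : l2norm w ^+ 2 = \sum_(k < n) normc (a k) ^+ 2 by exact: l2norm_comb_e.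
  have dw : dot (T w) y = (l2norm w ^+ 2)%:C%C.
    rewrite nw lin_sum// dot_suml rmorph_sum; apply: eq_bigr => k _.
    by rewrite linZ// dotZl [RHS]sqr_normcC /a conjCK.
  have := cauchy_schwarz (T w) y; rewrite dw.
  rewrite (normc_real (sqr_ge0 _)).
  move=> h; rewrite -nw ler_pXn2r ?nnegrE ?l2norm_ge0//.
  have w0 := l2norm_ge0 w; have := hC w; have y0 := l2norm_ge0 y.
  move: h; rewrite expr2 => h1 h2.
  have h3 : l2norm w * l2norm w <= (C * l2norm y) * l2norm w.
    by apply: le_trans h1 _; rewrite mulrAC ler_wpM2r.
  move: w0; rewrite le_eqVlt => /predU1P[<-//|w0].
  by rewrite -(ler_pM2r w0).
move=> z [za zC]; exists z; split => // x.
apply/eqP; rewrite -subr_eq0; apply/eqP/normc_le0.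
apply: (@le0_eps _ _ (C * l2norm y + l2norm z)).
  by rewrite addr_ge0// l2norm_ge0.
move=> e /(trunc_cvg x)[N /(_ N (leqnn _)) hN].
have -> : dot (T x) y - dot x z = dot (T (x - trunc N x)) y - dot (x - trunc N x) z.
  rewrite linB// !dotBl -addrA; congr (_ + _); rewrite opprB addrA addrC.
  rewrite -[LHS]addr0; congr (_ + _); apply/esym/eqP; rewrite addrC subr_eq0.
  apply/eqP.
  rewrite /trunc lin_sum// dot_suml dot_comb_e; apply: eq_bigr => k _.
  by rewrite linZ// dotZl za conjCK.
apply: le_trans (le_normcD _ _) _; rewrite normcN mulrDl; apply: lerD.
  apply: le_trans (cauchy_schwarz _ _) _; rewrite mulrAC ler_wpM2r ?l2norm_ge0//.
  by apply: le_trans (hC _) _; rewrite ler_wpM2l.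
apply: le_trans (cauchy_schwarz _ _) _; rewrite mulrC.
by rewrite ler_wpM2l ?l2norm_ge0.
Qed.

(** [adjoint] is a choice with default 0, so it has its properties only once a candidate is
    exhibited: the Riesz vectors, collected by choice, are linear in y because they are determined
    by their inner products. *)
Lemma adjoint_spec T : bounded_op T ->
  bounded_op (adjoint T) /\ forall x y, dot (T x) y = dot x (adjoint T y).
Proof.
move=> /bounded_opP[lT [C C0 hC]].
have /choice[B hB] := fun y => riesz y lT C0 hC.
rewrite /adjoint; case: xgetP => // /(_ B) []; split; last first.
  by move=> x y; rewrite (hB y).1.
split; last by exists C => x; exact: (hB x).2.
move=> a x y; apply: l2_dot_ext => z.
rewrite [LHS]dotC -(hB _).1 [RHS]dotC !dotDr !dotZr.
by rewrite -!(hB _).1.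
Qed.

Lemma adjointE T : bounded_op T -> forall x y, dot (T x) y = dot x (adjoint T y).
Proof. by move=> /adjoint_spec[]. Qed.

Lemma adjointEr T : bounded_op T -> forall x y, dot x (T y) = dot (adjoint T x) y.
Proof. by move=> bT x y; rewrite dotC adjointE// -dotC. Qed.

Lemma bounded_adjoint T : bounded_op T -> bounded_op (adjoint T).
Proof. by move=> /adjoint_spec[]. Qed.

Lemma adjoint_uniq T B : bounded_op T ->
  (forall x y, dot (T x) y = dot x (B y)) -> adjoint T = B.
Proof.
move=> bT h; apply/funext => y; apply: l2_dot_ext => z.
by rewrite dotC -adjointE// h -dotC.
Qed.

Lemma adjoint_bound T (C : R) : bounded_op T -> 0 <= C ->
  (forall x, l2norm (T x) <= C * l2norm x) ->
  forall x, l2norm (adjoint T x) <= C * l2norm x.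
Proof.
move=> bT C0 hC x; have [z [hz zC]] := riesz x bT.1 C0 hC.
suff -> : adjoint T x = z by [].
by apply: l2_dot_ext => y; rewrite dotC -adjointE// hz -dotC.
Qed.

End Adjoint.

(** * Weak limits and weak operator compactness *)

Section Tends0.
Variable R : realType.
Implicit Types (u v : nat -> R).

(** One-sided, without absolute value, so that upper estimates chain directly; it amounts to
    convergence to 0 exactly for the nonnegative sequences to which it is transferred. *)
Definition tends0 u := forall e, 0 < e -> exists N, forall n, (N <= n)%N -> u n <= e.

Lemma tends0P u : (forall n, 0 <= u n) -> (u @ \oo --> 0) <-> tends0 u.
Proof.
move=> u0; split => [/cvgrPdist_le h e /h [N _ hN]|h].
  exists N => n Nn; have := hN n Nn; rewrite sub0r normrN.
  by apply: le_trans; exact: ler_norm.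
apply/cvgrPdist_le => e /h [N hN]; exists N => // n Nn.
by rewrite sub0r normrN ger0_norm ?u0// hN.
Qed.

Lemma tends0_le u v : (forall n, u n <= v n) -> tends0 v -> tends0 u.
Proof.
move=> uv hv e /hv[N hN]; exists N => n /hN; exact: le_trans (uv n).
Qed.

Lemma tends0_const0 : tends0 (fun=> 0).
Proof. by move=> e /ltW e0; exists 0%N. Qed.

Lemma tends0D u v : tends0 u -> tends0 v -> tends0 (fun n => u n + v n).
Proof.
move=> hu hv e e0; have e2 : 0 < e / 2 by rewrite divr_gt0.
have [N hN] := hu _ e2; have [K hK] := hv _ e2; exists (maxn N K) => n.
by rewrite geq_max => /andP[/hN h1 /hK h2]; lra.
Qed.

Lemma tends0Z u (c : R) : 0 <= c -> tends0 u -> tends0 (fun n => c * u n).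
Proof.
move=> c0 hu e e0; have c1 : 0 < c + 1 by lra.
have [N hN] := hu (e / (c + 1)) (divr_gt0 e0 c1).
exists N => n /hN h; apply: le_trans (ler_wpM2l c0 h) _.
by rewrite mulrCA ger_pMr// ler_pdivrMr// mul1r; lra.
Qed.

Lemma tends0_sum (K : nat) (F : nat -> nat -> R) :
  (forall k, (k < K)%N -> tends0 (F k)) -> tends0 (fun n => \sum_(k < K) F k n).
Proof.
elim: K => [|K IH] h.
  by apply: tends0_le tends0_const0 => n; rewrite big_ord0.
apply: (@tends0_le _ (fun n => \sum_(k < K) F k n + F K n)).
  by move=> n; rewrite big_ord_recr.
by apply: tends0D; [apply: IH => k kK; apply: h; exact: ltnW|exact: h].
Qed.

Lemma increasing_seq_ge (g : nat -> nat) : increasing_seq g -> forall n, (n <= g n)%N.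
Proof.
move=> /increasing_seqP h; elim=> // n IH; apply: leq_ltn_trans IH _.
by have := h n; rewrite ltEnat.
Qed.

Lemma tends0_sub u (g : nat -> nat) : (forall n, (n <= g n)%N) -> tends0 u ->
  tends0 (u \o g).
Proof.
move=> hg hu e /hu[N hN]; exists N => n Nn; apply: hN.
exact: leq_trans Nn (hg n).
Qed.

(** The approximation argument: the null sequence v may depend on e, as it does when a vector is
    truncated at an e-dependent rank. *)
Lemma tends0_eps u (K : R) : 0 <= K ->
  (forall e, 0 < e -> exists2 v, tends0 v & forall n, u n <= v n + K * e) -> tends0 u.
Proof.
move=> K0 h e e0; have K1 : 0 < K + 1 by lra.
have e1 : 0 < e / (2 * (K + 1)) by rewrite divr_gt0// mulr_gt0.
have e2 : 0 < e / 2 by rewrite divr_gt0.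
have [v /(_ _ e2)[N hN] uv] := h _ e1; exists N => n /hN hn.
apply: le_trans (uv n) _.
have : K * (e / (2 * (K + 1))) <= e / 2.
  have -> : K * (e / (2 * (K + 1))) = (K / (K + 1)) * (e / 2) by field; lra.
  by rewrite ger_pMl// ler_pdivrMr// mul1r; lra.
lra.
Qed.

Lemma tends0_cvg u : (forall n, 0 <= u n) -> tends0 u -> u @ \oo --> 0.
Proof. by move=> u0; rewrite tends0P. Qed.

Lemma tends0_const u (c : R) : tends0 u -> (forall n, c <= u n) -> c <= 0.
Proof.
move=> h cu; rewrite leNgt; apply/negP => c0.
have /h[N /(_ N (leqnn _))] : 0 < c / 2 by rewrite divr_gt0.
have := cu N; lra.
Qed.

Lemma geometric_tends0 (r C : R) : 0 <= r -> r < 1 -> 0 <= C ->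
  tends0 (fun n => r ^+ n * C).
Proof.
move=> r0 r1 C0; apply: (@tends0_le _ (fun n => C * r ^+ n)).
  by move=> n; rewrite mulrC.
apply: tends0Z => //; apply/tends0P; first by move=> n; rewrite exprn_ge0.
by apply: cvg_expr; rewrite ger0_norm.
Qed.

End Tends0.

(** * Diagonal extraction of subsequences *)

Section Diagonal.
Variable R : realType.

Lemma diagonal_nat (a : nat -> nat -> R) (C : R) : (forall n p, `|a n p| <= C) ->
  exists g : nat -> nat, increasing_seq g /\
    forall p, cvgn (fun n => a (g n) p).
Proof.
move=> aC.
have ex (gp : (nat -> nat) * nat) : exists f : nat -> nat,
    increasing_seq f /\ cvgn (fun n => a (gp.1 (f n)) gp.2).
  have [|f fi fc] := @bolzano_weierstrass R (fun n => a (gp.1 n) gp.2).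
    exists C; split; first by rewrite realE (le_trans _ (aC 0%N 0%N)).
    by move=> x Cx n _ /=; exact: le_trans (aC _ _) (ltW Cx).
  by exists f.
have [F hF] := choice ex.
(* [G p] is the p-th of the nested subsequences: along [G p.+1] the columns 0 to p of [a] converge.
   The diagonal n -> [G n n] is the subsequence sought. *)
pose G := fix G p := if p is q.+1 then G q \o F (G q, q) else id.
have Gi p : increasing_seq (G p).
  elim: p => [//|p IH] n m /=.
  by rewrite IH -leEnat (hF (G p, p)).1.
(* From stage p on, every later subsequence runs through [G p] at indices that are at least as
   large; k only bounds n - p for the induction. *)
have tail k p n : (n <= p + k)%N -> (p <= n)%N ->
    forall i, exists2 m, (i <= m)%N & G n i = G p m.
  elim: k n => [|k IH] n npk pn i.
    have -> : n = p by apply/eqP; rewrite eqn_leq pn -(addn0 p) npk.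
    by exists i.
  move: pn; rewrite leq_eqVlt => /predU1P[<-|]; first by exists i.
  case: n npk => // n; rewrite addnS !ltnS => npk pn.
  have [m im Em] := IH n npk pn (F (G n, n) i).
  exists m => //; apply: leq_trans im.
  exact: increasing_seq_ge (hF (G n, n)).1 i.
exists (fun n => G n n); split.
  apply/increasing_seqP => n /=; rewrite ltEnat /=.
  have := increasing_seq_ge (hF (G n, n)).1 n.+1.
  have := leqW_mono (Gi n); rewrite /= => h.
  by rewrite (leqW_mono (Gi n)).
move=> p; have [_ /= /cvgrPdist_le hc] := hF (G p, p).
apply/cvg_ex; exists (limn (fun n => a (G p (F (G p, p) n)) p)).
apply/cvgrPdist_le => e e0; have [N _ hN] := hc e e0.
(* Column p converges along [G p.+1], not yet along [G p], so the diagonal is followed from p.+1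
   on. *)
exists (maxn N p.+1) => // n /=; rewrite geq_max => /andP[Nn pn].
have [m nm ->] := tail n p.+1 n (leq_addl _ _) pn n.
by apply: hN => /=; exact: leq_trans Nn nm.
Qed.

Lemma diagonal (I : countType) (a : nat -> I -> R) (C : R) : 0 <= C ->
  (forall n i, `|a n i| <= C) ->
  exists g : nat -> nat, increasing_seq g /\
    exists l : I -> R, forall i, tends0 (fun n => `|a (g n) i - l i|).
Proof.
move=> C0 aC.
have [|g [gi gc]] := @diagonal_nat
    (fun n p => if unpickle p is Some i then a n i else 0) C.
  by move=> n p; case: unpickle => // ; rewrite normr0.
exists g; split => //.
exists (fun i => limn (fun n => a (g n) i)) => i.
have := gc (pickle i); rewrite pickleK => /cvgrPdist_le h e /h[N _ hN].
by exists N => n Nn; rewrite distrC; exact: hN.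
Qed.

End Diagonal.

Section WeakCompactness.
Variable R : realType.
Implicit Types (x y z : l2 R).

Lemma tends0_uniq (a : nat -> R[i]) b c : tends0 (fun n => normc (a n - b)) ->
  tends0 (fun n => normc (a n - c)) -> b = c.
Proof.
move=> hb hc; apply/eqP; rewrite -subr_eq0; apply/eqP/normc_le0.
apply: tends0_const (tends0D hb hc) _ => n.
rewrite [normc (a n - b)]normcB.
have -> : b - c = (b - a n) + (a n - c) by rewrite subrKA.
exact: le_normcD.
Qed.

Lemma normc_le_ReIm (z : R[i]) : normc z <= `|complex.Re z| + `|complex.Im z|.
Proof.
rewrite -(@ler_pXn2r _ 2) ?nnegrE ?normc_ge0 ?addr_ge0//.
rewrite sqr_normcE sqrrD !real_normK ?num_real//.
have := normr_ge0 (complex.Re z); have := normr_ge0 (complex.Im z); nra.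
Qed.

(** Finite sections of [a] are limits of truncations of [u n], so they inherit the bound C and [a]
    is a vector of l2. For the pairing with y, the truncation of y involves finitely many
    coordinates and its tail is controlled by the uniform bound. *)
Lemma weak_limit (u : nat -> l2 R) (C : R) (a : nat -> R[i]) : 0 <= C ->
  (forall n, l2norm (u n) <= C) ->
  (forall k, tends0 (fun n => normc (u n k - a k))) ->
  exists z, [/\ forall k, z k = a k, l2norm z <= C &
    forall y, tends0 (fun n => normc (dot (u n) y - dot z y))].
Proof.
move=> C0 uC ua.
have comb K : l2norm (\sum_(k < K) a k *: e_ k : l2 R) <= C.
  rewrite -subr_le0; have h := tends0_sum (fun k _ => ua k) (K := K).
  apply: tends0_const h _ => n.
  have := l2norm_tri (\sum_(k < K) a k *: e_ k : l2 R) (trunc K (u n)).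
  rewrite l2normB /trunc -sumrB => h; rewrite lerBlDr addrC; apply: le_trans h _.
  apply: lerD; first exact: le_trans (l2norm_trunc_le _ _) (uC n).
  apply: le_trans (l2norm_sum _ _ _) _; apply: ler_sum => k _.
  by rewrite -scalerBl l2normZ l2norm_e mulr1.
have [] := @mk_l2 R a C => //.
  by move=> n; rewrite -l2norm_comb_e ler_pXn2r ?nnegrE ?l2norm_ge0.
move=> z [za zC]; exists z; split => // y.
apply: (@tends0_eps _ _ (C + C)); first by rewrite addr_ge0.
move=> e /(trunc_cvg y)[K /(_ K (leqnn _)) hK].
exists (fun n => \sum_(k < K) normc (y k) * normc (u n k - a k)).
  apply: (@tends0_sum R K (fun k n => normc (y k) * normc (u n k - a k))) => k _.
  by apply: tends0Z; [exact: normc_ge0|exact: ua].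
move=> n; rewrite -dotBl -{1}(subrK (trunc K y) y) dotDr addrC.
apply: le_trans (le_normcD _ _) _; apply: lerD.
  rewrite dotC normc_conj dot_comb_e; apply: le_trans (normc_sum _ _ _) _.
  by apply: ler_sum => k _; rewrite normcM normc_conj l2BE za.
apply: le_trans (cauchy_schwarz _ _) _; apply: ler_pM; rewrite ?l2norm_ge0//.
by apply: le_trans (l2normD _ _) _; rewrite l2normN; exact: lerD.
Qed.

(** The diagonal argument makes all matrix entries converge. Passing from basis vectors to arbitrary
    x is done twice, first through the rows (adjoints applied to basis vectors) and then through the
    images of x, each time by [weak_limit]. *)
Lemma wot_compact (A : nat -> l2 R -> l2 R) (C : R) : 0 <= C ->
  (forall n, linear (A n)) -> (forall n x, l2norm (A n x) <= C * l2norm x) ->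
  exists g L, [/\ increasing_seq g, linear L,
    forall x, l2norm (L x) <= C * l2norm x &
    forall x y, tends0 (fun n => normc (dot (A (g n) x) y - dot (L x) y))].
Proof.
move=> C0 lA bA.
have bdA n : bounded_op (A n) by split => //; exists C.
(* The Boolean selects real or imaginary part, since the extraction lemma is about real
   sequences. *)
pose a n (p : nat * nat * bool) : R := let z := A n (e_ p.1.1) p.1.2 in
  if p.2 then complex.Re z else complex.Im z.
have [|g [gi [l hl]]] := @diagonal R _ a C C0.
  move=> n [[j i] b]; rewrite /a /=; apply: (@le_trans _ _ (normc (A n (e_ j) i))).
    have := sqr_normcE (A n (e_ j) i); set z := A n (e_ j) i => sz.
    rewrite -(@ler_pXn2r _ 2) ?nnegrE ?normc_ge0// sz.
    by case: b; rewrite real_normK ?num_real// (lerDl, lerDr) sqr_ge0.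
  apply: le_trans (coord_le _ _) _; apply: le_trans (bA _ _) _.
  by rewrite l2norm_e mulr1.
pose m j i := Complex (l (j, i, true)) (l (j, i, false)).
have hm j i : tends0 (fun n => normc (A (g n) (e_ j) i - m j i)).
  apply: tends0_le (tends0D (hl (j, i, true)) (hl (j, i, false))) => n.
  apply: le_trans (normc_le_ReIm _) _; rewrite /a /m /=.
  by case: (A (g n) (e_ j) i).
(* The weak limit [r] of the i-th rows shows that coordinate i of [A (g n) x] converges for every x;
   this is the coordinatewise hypothesis needed to get a weak limit of [A (g n) x]. *)
have rows i : exists r, l2norm r <= C /\
    forall x, tends0 (fun n => normc (A (g n) x i - dot x r)).
  have [] := @weak_limit (fun n => adjoint (A (g n)) (e_ i)) C (fun j => (m j i)^*) C0.
  - move=> n; apply: le_trans (adjoint_bound (bdA _) C0 (bA _) _) _.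
    by rewrite l2norm_e mulr1.
  - move=> j; apply: tends0_le (hm j i) => n.
    rewrite -dot_e -adjointEr// dotC dot_e.
    by rewrite -rmorphB normc_conj.
  move=> r [_ rC hr]; exists r; split => // x; apply: tends0_le (hr x) => n.
  by rewrite -dot_e adjointE// -dotBr -dotBl dotC normc_conj.
have [r hr] := choice rows.
have cols x : exists z, [/\ forall i, z i = dot x (r i), l2norm z <= C * l2norm x &
    forall y, tends0 (fun n => normc (dot (A (g n) x) y - dot z y))].
  apply: weak_limit => //; first by rewrite mulr_ge0// l2norm_ge0.
  by move=> i; exact: (hr i).2.
have [L hL] := choice cols.
exists g, L; split => //.
- move=> b x y; apply: l2_ext => i.
  have [h _ _] := hL (b *: x + y); rewrite h dotDl dotZl.
  by have [h1 _ _] := hL x; have [h2 _ _] := hL y; rewrite -h1 -h2.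
- by move=> x; have [_ h _] := hL x.
- by move=> x y; have [_ _ h] := hL x.
Qed.

End WeakCompactness.

Section OperatorNorm.
Variable R : realType.
Implicit Types (x y : l2 R) (T : l2 R -> l2 R).

Lemma opnorm_set T : bounded_op T ->
  has_sup [set l2norm (T x) | x in [set x | l2norm x <= 1]].
Proof.
move=> /bounded_opP[lT [C C0 hC]]; split.
  by exists (l2norm (T 0)), 0 => //=; rewrite l2norm0.
exists C => _ [x /= x1 <-]; apply: le_trans (hC x) _.
by rewrite -[leRHS]mulr1 ler_wpM2l.
Qed.

Lemma opnorm_ge0 T : bounded_op T -> 0 <= opnorm T.
Proof.
move=> bT; apply: le_trans (l2norm_ge0 (T 0)) _.
apply: ub_le_sup; first exact: (opnorm_set bT).2.
by exists 0 => //=; rewrite l2norm0.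
Qed.

Lemma opnorm_bound T : bounded_op T -> forall x, l2norm (T x) <= opnorm T * l2norm x.
Proof.
move=> bT x; have [->|x0] := eqVneq x 0.
  by rewrite (lin0 bT.1) !l2norm0 mulr0.
have nx := l2norm_gt0 x0.
pose a : R[i] := ((l2norm x)^-1)%:C%C.
have na : normc a = (l2norm x)^-1.
  by rewrite normc_real// invr_ge0 ltW.
rewrite -ler_pdivrMr// mulrC -na -l2normZ -(linZ bT.1).
apply: ub_le_sup; first exact: (opnorm_set bT).2.
by exists (a *: x) => //=; rewrite l2normZ na mulVf ?gt_eqF.
Qed.

Lemma opnorm_le T (C : R) : 0 <= C -> (forall x, l2norm (T x) <= C * l2norm x) ->
  opnorm T <= C.
Proof.
move=> C0 h; apply: ge_sup.
  by exists (l2norm (T 0)), 0 => //=; rewrite l2norm0.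
move=> _ [x /= x1 <-]; apply: le_trans (h x) _.
by rewrite -[leRHS]mulr1 ler_wpM2l.
Qed.

Lemma bounded_comp T1 T2 : bounded_op T1 -> bounded_op T2 -> bounded_op (T1 \o T2).
Proof.
move=> /bounded_opP[l1 [C1 C10 h1]] /bounded_opP[l2 [C2 C20 h2]]; split.
  by move=> a x y /=; rewrite l2 l1.
exists (C1 * C2) => x /=; apply: le_trans (h1 _) _.
by rewrite -mulrA ler_wpM2l.
Qed.

Lemma fun_subE T1 T2 x : (T1 - T2) x = T1 x - T2 x.
Proof. by []. Qed.

Lemma fun_0E x : (0 : l2 R -> l2 R) x = 0.
Proof. by []. Qed.

Lemma bounded_sub T1 T2 : bounded_op T1 -> bounded_op T2 -> bounded_op (T1 - T2).
Proof.
move=> [l1 [C1 h1]] [l2 [C2 h2]]; split.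
  move=> a x y; rewrite !fun_subE l1 l2 scalerBr !opprD !addrA; congr (_ + _).
  by rewrite -!addrA; congr (_ + _); rewrite addrC.
exists (C1 + C2) => x; apply: le_trans (l2normD _ _) _; rewrite l2normN mulrDl.
exact: lerD.
Qed.

Lemma bounded_id : bounded_op (idfun : l2 R -> l2 R).
Proof. by split => //; exists 1 => x; rewrite mul1r. Qed.

Lemma bounded_zero : bounded_op (0 : l2 R -> l2 R).
Proof.
split; first by move=> a x y; rewrite !fun_0E scaler0 addr0.
by exists 0 => x; rewrite mul0r fun_0E l2norm0.
Qed.

End OperatorNorm.

(** * Orthogonal projections and gaps *)

Section Projections.
Variable R : realType.
Implicit Types (x y : l2 R) (P E F : l2 R -> l2 R) (V W : set (l2 R)).

(** The empty set qualifies; [V 0] is therefore a separate hypothesis wherever a possibly empty sum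
    is formed. *)
Definition linear_subspace V := forall a x y, V x -> V y -> V (a *: x + y).

Lemma linear_subspaceB V x y : linear_subspace V -> V x -> V y -> V (x - y).
Proof. by move=> sV Vx Vy; rewrite addrC -scaleN1r; exact: sV. Qed.

Section OrthProj.
Variable P : l2 R -> l2 R.
Hypothesis hP : is_orthproj P.

Lemma orthproj_lin : linear P.
Proof. by case: hP => -[]. Qed.

Lemma orthproj_idem x : P (P x) = P x.
Proof. by case: hP => _ h _; rewrite -[LHS]/((P \o P) x) h. Qed.

Lemma orthproj_sa x y : dot (P x) y = dot x (P y).
Proof. by case: hP => bP _ h; rewrite adjointE// h. Qed.

Lemma orthproj_range x : range P x -> P x = x.
Proof. by move=> [y _ <-]; exact: orthproj_idem. Qed.

Lemma orthproj_in_range x : range P (P x).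
Proof. by exists x. Qed.

Lemma orthproj_orth x y : dot (x - P x) (P y) = 0.
Proof. by rewrite -orthproj_sa (linB orthproj_lin) orthproj_idem subrr dot0l. Qed.

Lemma orthproj_orth_range x y : range P y -> dot (x - P x) y = 0.
Proof. by move=> [z _ <-]; exact: orthproj_orth. Qed.

Lemma orthproj_compl x : P (x - P x) = 0.
Proof. by rewrite (linB orthproj_lin) orthproj_idem subrr. Qed.

Lemma orthproj_pyth x : l2norm x ^+ 2 = l2norm (P x) ^+ 2 + l2norm (x - P x) ^+ 2.
Proof.
have o : dot (P x) (x - P x) = 0 by apply: dot_eq0C; exact: orthproj_orth.
by rewrite -(pythagoras o) [P x + _]addrC subrK.
Qed.

Lemma orthproj_le x : l2norm (P x) <= l2norm x.
Proof.
by rewrite -(@ler_pXn2r _ 2) ?nnegrE ?l2norm_ge0// (orthproj_pyth x) lerDl sqr_ge0.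
Qed.

Lemma orthproj_compl_le x : l2norm (x - P x) <= l2norm x.
Proof.
by rewrite -(@ler_pXn2r _ 2) ?nnegrE ?l2norm_ge0// (orthproj_pyth x) lerDr sqr_ge0.
Qed.

Lemma subspace_range : linear_subspace (range P).
Proof.
by move=> a _ _ [x _ <-] [y _ <-]; exists (a *: x + y); rewrite // orthproj_lin.
Qed.

End OrthProj.

(** A decomposition of x into a part in V and a part orthogonal to V is unique. Linearity and
    idempotence follow from this uniqueness, the bound from Pythagoras, self-adjointness from
    orthogonality. *)
Lemma is_orthprojP E V : linear_subspace V -> (forall x, V (E x)) ->
  (forall x v, V v -> dot (x - E x) v = 0) -> is_orthproj E /\ range E = V.
Proof.
move=> sV EV EO.
have uniq x v : V v -> (forall w, V w -> dot (x - v) w = 0) -> E x = v.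
  move=> Vv hv; have Vd : V (E x - v) by exact: linear_subspaceB.
  apply/eqP; rewrite -subr_eq0; apply/eqP/dot_eq0.
  have e : E x - v = (x - v) - (x - E x) by rewrite [RHS]addrC opprB subrKA.
  by rewrite {1}e dotBl EO// hv// subrr.
have lE : linear E.
  move=> a x y; apply: uniq; first exact: sV.
  move=> w Vw; rewrite opprD addrACA -scalerBr dotDl dotZl !EO//.
  by rewrite mulr0 addr0.
have Eid v : V v -> E v = v.
  by move=> Vv; apply: uniq => // w _; rewrite subrr dot0l.
have bE : bounded_op E.
  split=> //; exists 1 => x; rewrite mul1r.
  have := @pythagoras _ (E x) (x - E x); rewrite [_ + (x - _)]addrC subrK => h.
  rewrite -(@ler_pXn2r _ 2) ?nnegrE ?l2norm_ge0// h ?lerDl ?sqr_ge0//.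
  by apply: dot_eq0C; exact: EO.
split; last first.
  apply/seteqP; split => [_ [x _ <-]//|v Vv].
  by exists v => //; exact: Eid.
split=> //; first by apply/funext => x /=; exact: Eid.
apply: adjoint_uniq => // x y.
have h1 : dot (E x) (y - E y) = 0 by apply: dot_eq0C; exact: EO.
have h2 := EO x _ (EV y).
move: h1 h2; rewrite dotBl dotBr => /eqP; rewrite subr_eq0 => /eqP ->.
by move/eqP; rewrite subr_eq0 => /eqP ->.
Qed.

Lemma orthproj_uniq E F : is_orthproj E -> is_orthproj F -> range E = range F ->
  E = F.
Proof.
move=> hE hF EF; apply/funext => x; apply: l2_dot_ext => y.
have FEx : F (E x) = E x by apply: (orthproj_range hF); rewrite -EF.
have EFy : E (F y) = F y by apply: (orthproj_range hE); rewrite EF.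
by rewrite -FEx (orthproj_sa hF) (orthproj_sa hE) EFy -(orthproj_sa hF).
Qed.

Lemma orthprojE E V : is_orthproj E -> range E = V -> orthproj V = E.
Proof.
move=> hE <-; rewrite /orthproj; case: xgetP => [F _ [hF EF]|/(_ E) []//].
exact: orthproj_uniq.
Qed.

End Projections.

(** * Finite-dimensional subspaces *)

Section FiniteDimension.
Variable R : realType.
Implicit Types (x y : l2 R) (P E F : l2 R -> l2 R) (V W : set (l2 R)).

Lemma spanP n (v : 'I_n -> l2 R) x :
  family_span v x <-> exists c : 'I_n -> R[i], x = \sum_(i < n) c i *: v i.
Proof. by split => [[c _ <-]|[c ->]]; [exists c|exists c]. Qed.

Lemma span_mem n (v : 'I_n -> l2 R) i : family_span v (v i).
Proof.
apply/spanP; exists (fun j => (j == i)%:R).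
rewrite (bigD1 i)//= eqxx scale1r big1 ?addr0// => j /negPf ->.
by rewrite scale0r.
Qed.

Lemma subspace_span n (v : 'I_n -> l2 R) : linear_subspace (family_span v).
Proof.
move=> a _ _ [c _ <-] [d _ <-]; apply/spanP; exists (fun i => a * c i + d i).
rewrite scaler_sumr -big_split /=; apply: eq_bigr => i _.
by rewrite scalerDl scalerA.
Qed.

(** The coefficients of the orthogonal projection onto the span, found by inverting the Gram matrix:
    a combination in its kernel is orthogonal to every [v k], hence to itself. The constant K is
    read off the entries of the inverse. *)
Lemma gram_coords n (v : 'I_n -> l2 R) : lin_indep v ->
  exists c : l2 R -> 'I_n -> R[i],
    [/\ forall x k, dot (x - \sum_(i < n) c x i *: v i) (v k) = 0,
        forall d : 'I_n -> R[i], c (\sum_(i < n) d i *: v i) =1 d &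
        exists2 K : R, 0 <= K & forall x i, normc (c x i) <= K * l2norm x].
Proof.
move=> vi; pose G : 'M[R[i]]_n := \matrix_(i, j) dot (v i) (v j).
have combG (d : 'rV[R[i]]_n) k :
    (d *m G) 0 k = dot (\sum_(i < n) d 0 i *: v i) (v k).
  by rewrite mxE dot_suml; apply: eq_bigr => i _; rewrite mxE dotZl.
have Gu : G \in unitmx.
  rewrite -row_free_unit; apply: inj_row_free => d dG.
  apply/rowP => i; rewrite mxE; apply: (vi (fun i => d 0 i)).
  set s := \sum_(i < n) _; apply: dot_eq0.
  rewrite {2}/s dot_sumr big1// => k _; rewrite dotZr -combG dG mxE mulr0//.
pose b x : 'rV[R[i]]_n := \row_k dot x (v k).
pose c x i := (b x *m invmx G) 0 i.
have cO x k : dot (x - \sum_(i < n) c x i *: v i) (v k) = 0.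
  by rewrite dotBl -combG mulmxKV// mxE subrr.
exists c; split => //.
  move=> d i; set x := \sum_(i < n) d i *: v i; apply/eqP; rewrite eq_sym -subr_eq0.
  apply/eqP; move: i; apply: (vi (fun i => d i - c x i)).
  have rE : x - \sum_(i < n) c x i *: v i = \sum_(i < n) (d i - c x i) *: v i.
    by rewrite /x -sumrB; apply: eq_bigr => i _; rewrite scalerBl.
  rewrite -rE; apply: dot_eq0; rewrite [X in dot _ X]rE dot_sumr big1// => k _.
  by rewrite dotZr cO mulr0.
exists (\sum_i \sum_k l2norm (v k) * normc (invmx G k i)).
  apply: sumr_ge0 => i _; apply: sumr_ge0 => k _.
  by rewrite mulr_ge0 ?l2norm_ge0 ?normc_ge0.
move=> x i; apply: (@le_trans _ _
    ((\sum_k l2norm (v k) * normc (invmx G k i)) * l2norm x)).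
  rewrite /c mxE; apply: le_trans (normc_sum _ _ _) _; rewrite mulr_suml.
  apply: ler_sum => k _; rewrite mxE normcM mulrAC ler_wpM2r ?normc_ge0//.
  by rewrite mulrC cauchy_schwarz.
rewrite ler_wpM2r ?l2norm_ge0// [leRHS](bigD1 i)//= lerDl.
apply: sumr_ge0 => j _; apply: sumr_ge0 => k _.
by rewrite mulr_ge0 ?l2norm_ge0 ?normc_ge0.
Qed.

Lemma subspace_sum V n (c : 'I_n -> R[i]) (v : 'I_n -> l2 R) : linear_subspace V -> V 0 ->
  (forall i, V (v i)) -> V (\sum_(i < n) c i *: v i).
Proof.
move=> sV V0 Vv; elim/big_ind : _ => // [x y Vx Vy|i _].
  by rewrite -[x]scale1r; exact: sV.
by rewrite -[_ *: _]addr0; exact: sV.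
Qed.

Lemma has_dim_subspace V n : has_dim V n -> linear_subspace V /\ V 0.
Proof.
move=> [v [_ <-]]; split; first exact: subspace_span.
by apply/spanP; exists (fun=> 0); rewrite big1// => i _; rewrite scale0r.
Qed.

Lemma finite_dim_orthproj V n : has_dim V n -> is_orthproj (orthproj V) /\
  range (orthproj V) = V.
Proof.
move=> dV; have [sV _] := has_dim_subspace dV.
case: dV => v [vi vV]; have [c [cO _ _]] := gram_coords vi.
have [] := @is_orthprojP R (fun x => \sum_(i < n) c x i *: v i) V sV.
- by move=> x; rewrite -vV; apply/spanP; exists (c x).
- move=> x w; rewrite -vV => /spanP[d ->]; rewrite dot_sumr big1// => k _.
  by rewrite dotZr cO mulr0.
by move=> hE EV; rewrite (orthprojE hE EV).
Qed.

(** Injectivity makes the square matrix of F between the two bases invertible. This is the dimension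
    count behind [proj_dist_sym], [U_surj] and [Ti_range]. *)
Lemma inj_surj V W n F : linear F -> has_dim V n -> has_dim W n ->
  (forall x, V x -> W (F x)) -> (forall x, V x -> F x = 0 -> x = 0) ->
  forall w, W w -> exists2 x, V x & F x = w.
Proof.
move=> lF [v [vi <-]] [w [wi <-]] FVW Finj.
have /choice[C hC] i : exists c : 'I_n -> R[i], F (v i) = \sum_(j < n) c j *: w j.
  by apply/spanP/FVW/span_mem.
pose G : 'M[R[i]]_n := \matrix_(i, j) C i j.
have FG (d : 'rV[R[i]]_n) : F (\sum_i d 0 i *: v i) = \sum_j (d *m G) 0 j *: w j.
  rewrite lin_sum//; under eq_bigr do rewrite linZ// hC scaler_sumr.
  rewrite exchange_big /=; apply: eq_bigr => j _.
  by rewrite mxE scaler_suml; apply: eq_bigr => i _; rewrite mxE scalerA.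
have Gu : G \in unitmx.
  rewrite -row_free_unit; apply: inj_row_free => d dG.
  apply/rowP => i; rewrite mxE; apply: (vi (fun i => d 0 i)).
  apply: Finj; first by apply/spanP; exists (fun i => d 0 i).
  by rewrite FG dG big1// => j _; rewrite mxE scale0r.
move=> _ /spanP[d ->]; pose u := (\row_j d j) *m invmx G.
exists (\sum_i u 0 i *: v i); first by apply/spanP; exists (fun i => u 0 i).
by rewrite FG mulmxKV//; apply: eq_bigr => j _; rewrite mxE.
Qed.

Lemma image_dim V n F : linear F -> has_dim V n ->
  (forall x, V x -> F x = 0 -> x = 0) -> has_dim (F @` V) n.
Proof.
move=> lF [v [vi <-]] Finj; exists (F \o v); split.
  move=> c; under eq_bigr do rewrite -linZ//.
  rewrite -(lin_sum lF) => /Finj h; apply: vi; apply: h.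
  by apply/spanP; exists c.
apply/seteqP; split => [x /spanP[c ->]|_ [_ /spanP[c ->] <-]].
  exists (\sum_i c i *: v i); first by apply/spanP; exists c.
  by rewrite lin_sum//; apply: eq_bigr => i _; rewrite linZ.
by apply/spanP; exists c; rewrite lin_sum//; apply: eq_bigr => i _; rewrite linZ.
Qed.

(** The coefficients of y are also those of F y in the independent family F v_i, and such
    coefficients are bounded by a multiple of |F y|. *)
Lemma indep_lower_bound n (v : 'I_n -> l2 R) F : linear F ->
  lin_indep (F \o v) ->
  exists2 K : R, 0 <= K & forall y, family_span v y -> l2norm y <= K * l2norm (F y).
Proof.
move=> lF Fi; have [c [_ cd [K K0 hK]]] := gram_coords Fi.
exists (\sum_(i < n) K * l2norm (v i)).
  by apply: sumr_ge0 => i _; rewrite mulr_ge0// l2norm_ge0.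
move=> _ /spanP[d ->].
have Fd : F (\sum_i d i *: v i) = \sum_i d i *: (F \o v) i.
  by rewrite lin_sum//; apply: eq_bigr => i _; rewrite linZ.
rewrite mulr_suml; apply: le_trans (l2norm_sum _ _ _) _; apply: ler_sum => i _.
rewrite l2normZ mulrAC ler_wpM2r ?l2norm_ge0//.
by have := hK (F (\sum_i d i *: v i)) i; rewrite {1}Fd cd.
Qed.

End FiniteDimension.

(** * The gap between subspaces of equal finite dimension *)

Section Gap.
Variable R : realType.
Implicit Types (x y : l2 R) (E F : l2 R -> l2 R) (V W : set (l2 R)).

(** If d < 1, F is injective on ran(E), hence onto ran(F) by equality of dimensions. With F x = y
    one has |y|^2 = <E y, x> <= |E y| |x| and (1 - d^2) |x|^2 <= |y|^2, so |E y|^2 >= (1 - d^2)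
    |y|^2. For d >= 1 the bound is trivial. *)
Lemma proj_dist_sym E F n (d : R) : is_orthproj E -> is_orthproj F ->
  has_dim (range E) n -> has_dim (range F) n -> 0 <= d ->
  (forall x, range E x -> l2norm (x - F x) <= d * l2norm x) ->
  forall y, range F y -> l2norm (y - E y) <= d * l2norm y.
Proof.
move=> hE hF dE dF d0 EF y Fy; have [d1|d1] := leP 1 d.
  apply: le_trans (orthproj_compl_le hE _) _.
  by rewrite ler_peMl// l2norm_ge0.
have d2 : 0 < 1 - d ^+ 2 by rewrite subr_gt0 expr_lt1.
have inj x : range E x -> F x = 0 -> x = 0.
  move=> Ex Fx; have := EF x Ex; rewrite Fx subr0 => h.
  apply: l2norm_eq0; have := l2norm_ge0 x; nra.
have [x Ex Fx] := inj_surj (orthproj_lin hF) dE dF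
  (fun x _ => orthproj_in_range F x) inj Fy.
have hx := EF x Ex; have px := orthproj_pyth hF x; rewrite Fx in hx px.
have py := orthproj_pyth hE y.
have [y0|y0] := eqVneq y 0.
  by rewrite y0 (lin0 (orthproj_lin hE)) subr0 l2norm0 mulr0.
have ny := l2norm_gt0 y0.
have cs : l2norm y ^+ 2 <= l2norm (E y) * l2norm x.
  have <- : normc (dot (E y) x) = l2norm y ^+ 2.
    rewrite (orthproj_sa hE) (orthproj_range hE Ex) -{1}(orthproj_range hF Fy).
    rewrite (orthproj_sa hF) Fx dot_sqr.
    exact: normc_real (sqr_ge0 _).
  exact: cauchy_schwarz.
rewrite -(@ler_pXn2r _ 2) ?nnegrE ?mulr_ge0 ?l2norm_ge0// exprMn.
set a := l2norm (y - E y) in py *; set b := l2norm (E y) in py cs *.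
set c := l2norm x in px cs hx *; set t := l2norm (x - y) in px hx.
set s := l2norm y in px py cs ny *.
have [c0 b0 t0] : [/\ 0 <= c, 0 <= b & 0 <= t] by split; exact: l2norm_ge0.
have tc : t ^+ 2 <= d ^+ 2 * c ^+ 2.
  by rewrite -exprMn ler_pXn2r ?nnegrE ?mulr_ge0.
have sc : (1 - d ^+ 2) * c ^+ 2 <= s ^+ 2 by lra.
have cs2 : (s ^+ 2) ^+ 2 <= b ^+ 2 * c ^+ 2.
  by rewrite -exprMn ler_pXn2r ?nnegrE ?sqr_ge0 ?mulr_ge0.
have : (1 - d ^+ 2) * (s ^+ 2) ^+ 2 <= b ^+ 2 * s ^+ 2.
  apply: (@le_trans _ _ ((1 - d ^+ 2) * (b ^+ 2 * c ^+ 2))).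
    by rewrite ler_pM2l.
  by rewrite mulrCA ler_wpM2l ?sqr_ge0.
have s2 : 0 < s ^+ 2 by rewrite exprn_gt0.
rewrite [(s ^+ 2) ^+ 2]expr2 mulrA ler_pM2r//.
lra.
Qed.

(** E x - F x splits into a part in the kernel of F, bounded by d |E x|, and a part in ran(F),
    bounded by d |x - E x|. Both pairs are orthogonal, so the constant d is not enlarged. *)
Lemma proj_diff_le E F n (d : R) : is_orthproj E -> is_orthproj F ->
  has_dim (range E) n -> has_dim (range F) n -> 0 <= d ->
  (forall x, range E x -> l2norm (x - F x) <= d * l2norm x) ->
  forall x, l2norm (E x - F x) <= d * l2norm x.
Proof.
move=> hE hF dE dF d0 EF x.
have FE := proj_dist_sym hE hF dE dF d0 EF.
pose p := E x - F (E x); pose z := x - E x.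
have -> : E x - F x = p + - F z.
  by rewrite /p /z (linB (orthproj_lin hF)) opprB addrC subrKA addrC.
have o : dot p (- F z) = 0.
  by rewrite -scaleN1r dotZr (orthproj_orth hF) mulr0.
have h1 : l2norm p <= d * l2norm (E x) by apply: EF; exact: orthproj_in_range.
(* Duality: as E z = 0, |F z|^2 is the pairing of F z - E (F z) with z, and the reversed one-sided
   bound applies to F z. *)
have h2 : l2norm (F z) <= d * l2norm z.
  have hz : l2norm (F z) ^+ 2 <= (d * l2norm (F z)) * l2norm z.
    have e1 : dot (F z - E (F z)) z = (l2norm (F z) ^+ 2)%:C%C.
      rewrite dotBl (orthproj_sa hE) (orthproj_compl hE) dot0r subr0.
      by rewrite -dot_sqr (orthproj_sa hF) (orthproj_sa hF) orthproj_idem.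
    have := cauchy_schwarz (F z - E (F z)) z; rewrite e1.
    rewrite (normc_real (sqr_ge0 _)).
    move=> h; apply: le_trans h _; rewrite ler_wpM2r ?l2norm_ge0//.
    by apply: FE; exact: orthproj_in_range.
  have := l2norm_ge0 (F z); rewrite le_eqVlt => /predU1P[<-|f0].
    by rewrite mulr_ge0 ?l2norm_ge0.
  by rewrite -(ler_pM2r f0) -expr2 mulrAC.
rewrite -(@ler_pXn2r _ 2) ?nnegrE ?mulr_ge0 ?l2norm_ge0// (pythagoras o).
rewrite l2normN exprMn (orthproj_pyth hE x) -/z mulrDr -!exprMn.
by apply: lerD; rewrite ler_pXn2r ?nnegrE ?mulr_ge0 ?l2norm_ge0.
Qed.

Lemma gap_le V W n (d : R) : has_dim V n -> has_dim W n -> 0 <= d ->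
  (forall x, V x -> l2norm (x - orthproj W x) <= d * l2norm x) -> gap V W <= d.
Proof.
move=> dV dW d0 h.
have [hE rE] := finite_dim_orthproj dV; have [hF rF] := finite_dim_orthproj dW.
apply: opnorm_le => // x; rewrite fun_subE; apply: (@proj_diff_le _ _ n) => //.
- by rewrite rE.
- by rewrite rF.
- by rewrite rE.
Qed.

Lemma gap_le1 V W n : has_dim V n -> has_dim W n -> gap V W <= 1.
Proof.
move=> dV dW; apply: (gap_le dV dW) => // x _; rewrite mul1r.
by apply: orthproj_compl_le; case: (finite_dim_orthproj dW).
Qed.

Lemma bounded_orthproj_diff V W n : has_dim V n -> has_dim W n ->
  bounded_op (orthproj V - orthproj W).
Proof.
move=> dV dW; have [[bE _ _] _] := finite_dim_orthproj dV.
have [[bF _ _] _] := finite_dim_orthproj dW; exact: bounded_sub.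
Qed.

Lemma gap_ge0 V W n : has_dim V n -> has_dim W n -> 0 <= gap V W.
Proof. by move=> dV dW; apply: opnorm_ge0; exact: bounded_orthproj_diff dV dW. Qed.

Lemma gap_dist V W n x : has_dim V n -> has_dim W n ->
  l2norm (orthproj V x - orthproj W x) <= gap V W * l2norm x.
Proof.
by move=> dV dW; exact: (opnorm_bound (bounded_orthproj_diff dV dW) x).
Qed.

End Gap.

(** * The QR iteration *)

Section InitialSpan.
Variable R : realType.
Implicit Types (x y : l2 R) (T U : l2 R -> l2 R).

Definition initial_span K : set (l2 R) := family_span (fun j : 'I_K => e_ j).

Lemma lin_indep_e K : lin_indep (fun j : 'I_K => e_ j : l2 R).
Proof.
move=> c c0 i; have := congr1 (fun x => dot x (e_ i)) c0.
rewrite dot0l dot_suml (bigD1 i)//= dotZl dot_ee eqxx mulr1 big1 ?addr0// => j.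
rewrite eq_sym -val_eqE /= => /negPf ij.
by rewrite dotZl dot_ee ij mulr0.
Qed.

Lemma initial_span_dim K : has_dim (initial_span K) K.
Proof. by exists (fun j : 'I_K => e_ j); split => //; exact: lin_indep_e. Qed.

Lemma initial_spanP K x : initial_span K x <-> forall k, (K <= k)%N -> x k = 0.
Proof.
split=> [/spanP[c ->] k Kk|h].
  rewrite -dot_e dot_suml big1// => j _; rewrite dotZl dot_ee.
  by rewrite gtn_eqF ?mulr0// (leq_trans (ltn_ord j)).
apply/spanP; exists (fun j => x j); apply: l2_ext => k.
by rewrite comb_e_coord; case: ltnP => // /h.
Qed.

Lemma initial_span_e K j : (j < K)%N -> initial_span K (e_ j).
Proof. by move=> jK; exact: (span_mem (fun j : 'I_K => e_ j) (Ordinal jK)). Qed.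

Lemma initial_span_le K N x : (K <= N)%N -> initial_span K x -> initial_span N x.
Proof. by move=> KN /initial_spanP h; apply/initial_spanP => k /(leq_trans KN)/h. Qed.

Lemma linear_initial_span T K V : linear T -> linear_subspace V -> V 0 ->
  (forall j, (j < K)%N -> V (T (e_ j))) -> forall x, initial_span K x -> V (T x).
Proof.
move=> lT sV V0 h _ /spanP[c ->]; rewrite lin_sum//.
have -> : \sum_(i < K) T (c i *: e_ i) = \sum_(i < K) c i *: T (e_ i).
  by apply: eq_bigr => i _; rewrite linZ.
by apply: subspace_sum => // i; exact: h.
Qed.

Lemma upper_triangular_span U K : linear U -> upper_triangular U ->
  forall x, initial_span K x -> initial_span K (U x).
Proof.
move=> lU tU; have [sV V0] := has_dim_subspace (initial_span_dim K).
apply: linear_initial_span => // j jK; apply/initial_spanP => k Kk.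
by rewrite -dot_e; apply: tU; exact: leq_trans jK Kk.
Qed.

Lemma finite_columns_span T K : linear T -> finite_columns T ->
  exists N, forall x, initial_span K x -> initial_span N (T x).
Proof.
move=> lT fT.
have /choice[N hN] j : exists N, initial_span N (T (e_ j)).
  (* Successors, because [initial_span N] contains the indices strictly below N. *)
  have [s hs] := (finite_seqP _).1 (fT j); exists (\max_(i <- s) i.+1).
  apply/initial_spanP => k; rewrite -dot_e; apply: contraPeq => h.
  have ks : [set` s] k by rewrite -hs.
  by apply/negP; rewrite -ltnNge (@leq_bigmax_seq _ s xpredT (fun i => i.+1)).
exists (\max_(j < K) N j).
have [sV V0] := has_dim_subspace (initial_span_dim (\max_(j < K) N j)).
apply: linear_initial_span => // j jK.
by apply: initial_span_le (hN j); rewrite (leq_bigmax (Ordinal jK)).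
Qed.

End InitialSpan.

Section Unitary.
Variable R : realType.
Implicit Types (x y : l2 R) (Q : l2 R -> l2 R).

Lemma unitary_adjK Q x : unitary_op Q -> adjoint Q (Q x) = x.
Proof. by case=> _ h _; rewrite -[LHS]/((adjoint Q \o Q) x) h. Qed.

Lemma unitary_Kadj Q x : unitary_op Q -> Q (adjoint Q x) = x.
Proof. by case=> _ _ h; rewrite -[LHS]/((Q \o adjoint Q) x) h. Qed.

Lemma unitary_dot Q x y : unitary_op Q -> dot (Q x) (Q y) = dot x y.
Proof. by move=> uQ; rewrite adjointE ?unitary_adjK//; case: uQ. Qed.

Lemma unitary_norm Q x : unitary_op Q -> l2norm (Q x) = l2norm x.
Proof. by move=> uQ; rewrite /l2norm unitary_dot. Qed.

Lemma unitary_adj_norm Q x : unitary_op Q -> l2norm (adjoint Q x) = l2norm x.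
Proof. by move=> uQ; rewrite -(unitary_norm (adjoint Q x) uQ) unitary_Kadj. Qed.

Lemma adjoint_comp (S T : l2 R -> l2 R) : bounded_op S -> bounded_op T ->
  adjoint (S \o T) = adjoint T \o adjoint S.
Proof.
move=> bS bT; apply: adjoint_uniq; first exact: bounded_comp.
by move=> x y /=; rewrite !adjointE.
Qed.

Lemma unitary_comp Q1 Q2 : unitary_op Q1 -> unitary_op Q2 -> unitary_op (Q1 \o Q2).
Proof.
move=> u1 u2; have [b1 _ _] := u1; have [b2 _ _] := u2.
rewrite /unitary_op adjoint_comp//; split; first exact: bounded_comp.
- by apply/funext => x /=; rewrite !unitary_adjK.
- by apply/funext => x /=; rewrite !unitary_Kadj.
Qed.

Lemma unitary_id : unitary_op (idfun : l2 R -> l2 R).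
Proof.
have aid : adjoint (idfun : l2 R -> l2 R) = idfun.
  by apply: adjoint_uniq => //; exact: bounded_id.
by rewrite /unitary_op aid; split => //; exact: bounded_id.
Qed.

End Unitary.

Section QR.
Variables (R : realType) (T Ti : l2 R -> l2 R) (Q U : nat -> l2 R -> l2 R).
Hypotheses (bT : bounded_op T) (bTi : bounded_op Ti).
Hypothesis TiT : forall x, Ti (T x) = x.
Hypothesis QU : QR_sequences T Q U.

Lemma iter_inj n x : iter n T x = 0 -> x = 0.
Proof.
elim: n => //= n IH h; apply: IH; rewrite -(TiT (iter n T x)) h.
by rewrite (lin0 bTi.1).
Qed.

Lemma QR_props n : [/\ unitary_op (Q n), linear (U n),
  forall K x, initial_span K x -> initial_span K (U n x) &
  forall x, Q n (U n x) = iter n T x].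
Proof.
have [Ts [q [r [T0 hq [Q0 QS] [U0 US]]]]] := QU.
(* The added intertwining T Q_n = Q_n T_n carries the induction: Q_n q r U_n = Q_n T_n U_n = T Q_n
   U_n. *)
suff : [/\ unitary_op (Q n), linear (U n),
  forall K x, initial_span K x -> initial_span K (U n x),
  forall x, Q n (U n x) = iter n T x & forall x, T (Q n x) = Q n (Ts n x)].
  by case.
elim: n => [|n [uQ lU tU QUn TQ]].
  by rewrite Q0 U0 T0; split => //; exact: unitary_id.
have [[uq br tr Tqr] TS] := hq n.
have Tsx x : Ts n x = q n.+1 (r n.+1 x) by rewrite Tqr.
rewrite QS US; split.
- exact: unitary_comp.
- by move=> a x y /=; rewrite lU br.1.
- by move=> K x Kx /=; apply: upper_triangular_span tr _ _; [exact: br.1|exact: tU].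
- by move=> x /=; rewrite -Tsx -TQ QUn.
- by move=> x /=; rewrite TQ TS Tsx.
Qed.

Lemma Q_unitary n : unitary_op (Q n). Proof. by case: (QR_props n). Qed.

Lemma QU_iter n x : Q n (U n x) = iter n T x. Proof. by case: (QR_props n). Qed.

(** [U n] is injective because Q_n U_n = T^n is, and it maps the K-dimensional initial span into
    itself. *)
Lemma U_surj n K w : initial_span K w -> exists2 u, initial_span K u & U n u = w.
Proof.
have [_ lU tU QUn] := QR_props n => Kw.
apply: (inj_surj lU (initial_span_dim R K) (initial_span_dim R K) (tU K) _ Kw) => u _ Uu.
apply: (@iter_inj n); rewrite -QUn Uu.
by case: (Q_unitary n) => -[lQ _] _ _; exact: lin0.
Qed.

Lemma Q_span_iter n K x : family_span (fun j : 'I_K => Q n (e_ j)) x ->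
  exists2 u, initial_span K u & x = iter n T u.
Proof.
have [[lQ _] _ _] := Q_unitary n.
move=> /spanP[c ->]; pose w : l2 R := \sum_(j < K) c j *: e_ j.
have Kw : initial_span K w by apply/spanP; exists c.
have [u Ku Uu] := U_surj n Kw; exists u => //.
rewrite -QU_iter Uu /w lin_sum//; apply: eq_bigr => j _; rewrite linZ//.
Qed.

Lemma Q_span_dim n K : has_dim (family_span (fun j : 'I_K => Q n (e_ j))) K.
Proof.
have uQ := Q_unitary n; have [[lQ _] _ _] := uQ.
exists (fun j : 'I_K => Q n (e_ j)); split => // c c0.
apply: (lin_indep_e (R := R)); rewrite -(unitary_adjK (\sum_(j < K) _) uQ).
have -> : Q n (\sum_(j < K) c j *: e_ j) = \sum_(j < K) c j *: Q n (e_ j).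
  by rewrite lin_sum//; apply: eq_bigr => j _; rewrite linZ.
by rewrite c0; apply: lin0; apply: (bounded_adjoint _).1; case: uQ.
Qed.

Definition conj_iterate n := adjoint (Q n) \o T \o Q n.

Lemma conj_iterate_bounded n : bounded_op (conj_iterate n).
Proof.
have [bQ _ _] := Q_unitary n.
apply: bounded_comp => //; apply: bounded_comp => //; exact: bounded_adjoint.
Qed.

Lemma conj_iterate_le n x : l2norm (conj_iterate n x) <= opnorm T * l2norm x.
Proof.
rewrite /conj_iterate /= unitary_adj_norm//; last exact: Q_unitary.
by rewrite -[in leRHS](unitary_norm x (Q_unitary n)); exact: opnorm_bound.
Qed.

(* On a vector [U n u], [conj_iterate n] is [U n (T u)], and [U n] preserves
   every initial span; hence a bound independent of [n]. *)
Lemma conj_iterate_columns K : finite_columns T ->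
  exists N, forall n x, initial_span K x -> initial_span N (conj_iterate n x).
Proof.
move=> /(finite_columns_span K bT.1)[N hN]; exists N => n x /(U_surj n)[u Ku <-].
have [uQ _ tU _] := QR_props n.
by rewrite /conj_iterate /= QU_iter -iterS iterSr -QU_iter unitary_adjK//; exact/tU/hN.
Qed.

End QR.

(** * Strong convergence and the block form of limits *)

Section Convergence.
Variable R : realType.
Implicit Types (x y : l2 R) (L : l2 R -> l2 R) (A : nat -> l2 R -> l2 R).

Lemma fun_addE (S T : l2 R -> l2 R) x : (S + T) x = S x + T x.
Proof. by []. Qed.

Lemma fun_sumE (I : Type) (r : seq I) (p : pred I) (F : I -> l2 R -> l2 R) x :
  (\sum_(i <- r | p i) F i) x = \sum_(i <- r | p i) F i x.
Proof. by elim/big_rec2 : _ => // i y S _ <-. Qed.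

(** For fixed j the columns stay in one finite-dimensional span, which the limit column inherits;
    there coordinatewise convergence is norm convergence. The uniform bound C then extends this from
    basis vectors to every x. *)
Lemma strong_of_weak A L (C : R) : 0 <= C -> (forall n, linear (A n)) -> linear L ->
  (forall n x, l2norm (A n x) <= C * l2norm x) ->
  (forall x, l2norm (L x) <= C * l2norm x) ->
  (forall x y, tends0 (fun n => normc (dot (A n x) y - dot (L x) y))) ->
  (forall j, exists N, forall n, initial_span N (A n (e_ j))) ->
  forall x, tends0 (fun n => l2norm (A n x - L x)).
Proof.
move=> C0 lA lL bA bL AL col.
have colcvg j : tends0 (fun n => l2norm (A n (e_ j) - L (e_ j))).
  have [N hN] := col j.
  have Lspan : initial_span N (L (e_ j)).
    apply/initial_spanP => k Nk; rewrite -dot_e.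
    apply: (tends0_uniq (AL (e_ j) (e_ k))) => e /ltW e0; exists 0%N => n _.
    by rewrite dot_e ((initial_spanP _ _).1 (hN n) k Nk) subrr normc0.
  apply: tends0_le (@tends0_sum R N (fun k n =>
    normc (dot (A n (e_ j)) (e_ k) - dot (L (e_ j)) (e_ k))) (fun k _ => AL _ _)) => n.
  have -> : A n (e_ j) - L (e_ j) = trunc N (A n (e_ j) - L (e_ j)).
    apply: l2_ext => k; rewrite comb_e_coord; case: ltnP => // Nk.
    by rewrite l2BE ((initial_spanP _ _).1 (hN n) k Nk) ((initial_spanP _ _).1 Lspan k Nk) subrr.
  apply: le_trans (l2norm_sum _ _ _) _; apply: ler_sum => k _.
  by rewrite l2normZ l2norm_e mulr1 !dot_e.
move=> x; apply: (@tends0_eps _ _ (C + C)); first by rewrite addr_ge0.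
move=> e /(trunc_cvg x)[K /(_ K (leqnn _)) hK].
exists (fun n => \sum_(k < K) normc (x k) * l2norm (A n (e_ k) - L (e_ k))).
  apply: (@tends0_sum R K (fun k n => normc (x k) * l2norm (A n (e_ k) - L (e_ k)))) => k _.
  by apply: tends0Z; [exact: normc_ge0|exact: colcvg].
move=> n; have -> : A n x - L x = (A n (trunc K x) - L (trunc K x)) +
    (A n (x - trunc K x) - L (x - trunc K x)).
  by rewrite addrACA -opprD -linD// -linD// [_ + (x - _)]addrC subrK.
apply: le_trans (l2normD _ _) _; apply: lerD.
  rewrite /trunc (lin_sum (lA n)) (lin_sum lL) -sumrB; apply: le_trans (l2norm_sum _ _ _) _.
  by apply: ler_sum => k _; rewrite (linZ (lA n)) (linZ lL) -scalerBr l2normZ.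
apply: le_trans (l2normD _ _) _; rewrite l2normN mulrDl.
apply: lerD; [apply: le_trans (bA _ _) _|apply: le_trans (bL _) _];
  by rewrite ler_wpM2l.
Qed.

Lemma block_form_of_columns M L : bounded_op L ->
  (forall j, (j < M)%N -> initial_span M (L (e_ j))) -> block_form M L.
Proof.
move=> bL hL; split => //.
exists (fun j : 'I_M => L (e_ j)), (fun i => L (e_ i)); split.
  by move=> j; exact: hL.
move=> x; apply: tends0_cvg => [n|]; first exact: l2norm_ge0.
have [lL [C C0 hC]] := bounded_opP bL.
apply: (@tends0_eps _ _ C) => // e e0; have [N hN] := trunc_cvg x e0.
pose S n : l2 R -> l2 R := \sum_(j < M) rank_one (L (e_ j)) (e_ j) +
  \sum_(M <= i < n) rank_one (L (e_ i)) (e_ i).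
have SE n : (M <= n)%N -> S n x = L (trunc n x).
  move=> Mn; rewrite /S /trunc lin_sum//.
  have -> : \sum_(k < n) L (x k *: e_ k) = \sum_(0 <= k < n) L (x k *: e_ k).
    by rewrite big_mkord.
  rewrite fun_addE !fun_sumE [RHS](@big_cat_nat _ _ _ M)//=.
  rewrite [X in _ = X + _]big_mkord; congr (_ + _).
    by apply: eq_bigr => j _; rewrite /rank_one dot_e linZ.
  by apply: eq_bigr => j _; rewrite /rank_one dot_e linZ.
pose u n := l2norm (S n x - L x).
(* Below M the partial operator already contains all M leading terms and is not L after truncation
   at n; these finitely many values are put into the null sequence. *)
exists (fun n => if (maxn N M <= n)%N then 0 else u n).
  move=> d /ltW d0; exists (maxn N M) => n ->; exact: d0.
move=> n; rewrite -[l2norm _]/(u n); case: ifPn => [|_].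
  rewrite geq_max => /andP[Nn Mn]; rewrite /u SE// -(linB lL) add0r.
  by apply: le_trans (hC _) _; rewrite l2normB ler_wpM2l// hN.
by rewrite lerDl mulr_ge0// ltW.
Qed.

End Convergence.

(** * The coupling operator *)

Section Coupling.
Variables (R : realType) (T P Ti : l2 R -> l2 R) (M : nat) (alpha beta : R).
Hypotheses (bT : bounded_op T) (bTi : bounded_op Ti).
Hypotheses (TiT : forall x, Ti (T x) = x) (TTi : forall x, T (Ti x) = x).
Hypotheses (hP : is_orthproj P) (dP : has_dim (range P) M).
Hypothesis invP : op_invariant T (range P).
Hypotheses (beta_gt0 : 0 < beta) (beta_lt_alpha : beta < alpha).
Hypothesis T_below : forall x, range P x -> alpha * l2norm x <= l2norm (T x).
Hypothesis T_above : opnorm ((idfun - P) \o T \o (idfun - P)) <= beta.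
Implicit Types (x y : l2 R) (A : l2 R -> l2 R).

Let alpha_gt0 : 0 < alpha. Proof. exact: lt_trans beta_lt_alpha. Qed.
Let beta_ge0 : 0 <= beta. Proof. exact: ltW. Qed.
Let alpha_ge0 : 0 <= alpha. Proof. exact: ltW. Qed.
Let lT : linear T. Proof. by case: bT. Qed.
Let lTi : linear Ti. Proof. by case: bTi. Qed.
Let lP : linear P. Proof. exact: orthproj_lin. Qed.

Let bIP : bounded_op (idfun - P).
Proof. by apply: bounded_sub; [exact: bounded_id|case: hP]. Qed.

(** The blocks act on the whole space and vanish on ran(P), so that no operator between subspaces
    has to be formed. *)
Definition T22 : l2 R -> l2 R := (idfun - P) \o T \o (idfun - P).
Definition T12 : l2 R -> l2 R := P \o T \o (idfun - P).

Let bT22 : bounded_op T22.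
Proof. by do 2 apply: bounded_comp => //. Qed.

Lemma bounded_T12 : bounded_op T12.
Proof. by do 2 apply: bounded_comp => //; case: hP. Qed.

Lemma T22E x : T22 x = T (x - P x) - P (T (x - P x)). Proof. by []. Qed.
Lemma T12E x : T12 x = P (T (x - P x)). Proof. by []. Qed.

Lemma T_range x : range P x -> range P (T x).
Proof. by move=> Px; apply: invP; exists x. Qed.

Lemma PTP x : P (T (P x)) = T (P x).
Proof. by apply: (orthproj_range hP); apply: T_range; exact: orthproj_in_range. Qed.

(** T maps the finite-dimensional ran(P) injectively into itself, hence onto it. Thus the global
    inverse [Ti] can stand for the inverse of the block T_11. *)
Lemma Ti_range x : range P x -> range P (Ti x).
Proof.
move=> Px; have [|y Py <-] := inj_surj lT dP dP T_range _ Px.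
  by move=> y _ Ty; rewrite -(TiT y) Ty (lin0 lTi).
by rewrite TiT.
Qed.

Lemma T22_le x : l2norm (T22 x) <= beta * l2norm x.
Proof.
apply: le_trans (opnorm_bound bT22 x) _.
by rewrite ler_wpM2r ?l2norm_ge0.
Qed.

Lemma Ti_le x : range P x -> l2norm (Ti x) <= alpha^-1 * l2norm x.
Proof.
move=> Px; rewrite -[leRHS]mulrC ler_pdivlMr// mulrC -{2}(TTi x).
exact/T_below/Ti_range.
Qed.

Lemma inverse_Ti : inverse_on_range P T Ti.
Proof. by move=> x Px; split => //; exact: Ti_range. Qed.

Lemma inverse_uniq B x : inverse_on_range P T B -> range P x -> B x = Ti x.
Proof. by move=> hB /hB[_ _ h]; rewrite -[RHS]/(Ti x) -{2}h TiT. Qed.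

(** Its iterates from 0 are the partial sums of the Neumann series of A. On maps into ran(P) it
    contracts differences by the factor beta / alpha. *)
Definition coupling_step A x := Ti (A (T22 x)) - Ti (T12 x).

Lemma T22_P x : T22 (P x) = 0.
Proof. by rewrite T22E (orthproj_idem hP) subrr (lin0 lT) (lin0 lP) subrr. Qed.

Lemma T12_P x : T12 (P x) = 0.
Proof. by rewrite T12E (orthproj_idem hP) subrr (lin0 lT) (lin0 lP). Qed.

Lemma compl_range x : range (idfun - P) x -> x - P x = x.
Proof. by move=> [y _ <-]; rewrite fun_subE (orthproj_compl hP) subr0. Qed.

(** The defining equation, given on ran(I - P), becomes a fixed-point equation on the whole space
    because both sides vanish on ran(P); the block inverse B agrees with [Ti] wherever it is
    applied. *)
Lemma coupling_opP A : coupling_op P T A <->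
  [/\ bounded_op A, forall x, A (P x) = 0, forall x, range P (A x) &
      forall x, A x = coupling_step A x].
Proof.
split=> [[bA AP PA [B hB eqA]]|[bA AP PA eqA]].
  have AP' x : A (P x) = 0 by rewrite -[LHS]/((A \o P) x) AP.
  have PA' x : range P (A x) by exists (A x) => //; rewrite -[LHS]/((P \o A) x) PA.
  split => // x; have cx : range (idfun - P) (x - P x) by exists x.
  have := eqA _ cx; rewrite (inverse_uniq hB (PA' _)).
  rewrite (inverse_uniq hB (orthproj_in_range P _)) -T12E -T22E.
  rewrite (linB bA.1) AP' subr0 => h.
  by rewrite /coupling_step -h addrC subrK.
split => //.
- by apply/funext.
- by apply/funext => x /=; exact: orthproj_range.
- exists Ti; first exact: inverse_Ti.
  move=> y /compl_range yE; rewrite eqA /coupling_step T22E T12E yE.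
  by rewrite addrC addrA addNr add0r.
Qed.

Let t := opnorm T12.
(** The solution of (K beta + t) / alpha = K, i.e. the sum of the geometric series that dominates
    the Neumann series. *)
Let K := t / (alpha - beta).

Let ab : 0 < alpha - beta. Proof. by rewrite subr_gt0. Qed.
Let t0 : 0 <= t. Proof. exact: opnorm_ge0 bounded_T12. Qed.
Let K0 : 0 <= K. Proof. by rewrite divr_ge0// ltW. Qed.
Let Kt : K * (alpha - beta) = t. Proof. by rewrite divfK// gt_eqF. Qed.

Lemma coupling_step_le A (C : R) x : 0 <= C -> (forall x, range P (A x)) ->
  (forall x, l2norm (A x) <= C * l2norm x) ->
  l2norm (coupling_step A x) <= (C * beta + t) / alpha * l2norm x.
Proof.
move=> C0 PA hA; apply: le_trans (l2normD _ _) _; rewrite l2normN.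
have h1 : l2norm (Ti (T12 x)) <= alpha^-1 * (t * l2norm x).
  apply: le_trans (Ti_le _) _; first exact: orthproj_in_range.
  by rewrite ler_pM2l ?invr_gt0//; exact: (opnorm_bound bounded_T12 x).
have h2 : l2norm (Ti (A (T22 x))) <= alpha^-1 * (C * (beta * l2norm x)).
  apply: le_trans (Ti_le (PA _)) _; rewrite ler_pM2l ?invr_gt0//.
  by apply: le_trans (hA _) _; rewrite ler_wpM2l// T22_le.
apply: le_trans (lerD h2 h1) _.
by rewrite le_eqVlt; apply/orP; left; apply/eqP; ring.
Qed.

Lemma coupling_le A : coupling_op P T A -> forall x, l2norm (A x) <= K * l2norm x.
Proof.
move=> /coupling_opP[bA AP PA eqA].
have a0 := opnorm_ge0 bA.
have h : opnorm A <= (opnorm A * beta + t) / alpha.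
  apply: opnorm_le; first by rewrite divr_ge0 ?addr_ge0 ?mulr_ge0.
  by move=> x; rewrite eqA; apply: coupling_step_le => //; exact: opnorm_bound.
have {}h : opnorm A <= K.
  by move: h; rewrite ler_pdivlMr// => h; rewrite ler_pdivlMr// mulrBr lerBlDl.
move=> x; apply: le_trans (opnorm_bound bA x) _.
by rewrite ler_wpM2r ?l2norm_ge0.
Qed.

(* The difference [D] of two solutions satisfies [D = Ti D T22]. *)
Lemma coupling_uniq A A' : coupling_op P T A -> coupling_op P T A' -> A = A'.
Proof.
move=> /coupling_opP[bA _ PA eA] /coupling_opP[bA' _ PA' eA'].
have bD := bounded_sub bA bA'; have d0 := opnorm_ge0 bD.
have h : opnorm (A - A') <= opnorm (A - A') * beta / alpha.
  apply: opnorm_le; first by rewrite divr_ge0 ?mulr_ge0.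
  move=> x; rewrite fun_subE eA eA' /coupling_step opprB subrKA -(linB lTi).
  have hz : l2norm (A (T22 x) - A' (T22 x)) <= opnorm (A - A') * (beta * l2norm x).
    rewrite -fun_subE; apply: le_trans (opnorm_bound bD _) _.
    by rewrite ler_wpM2l// T22_le.
  have pr : range P (A (T22 x) - A' (T22 x)).
    by apply: linear_subspaceB => //; exact: subspace_range.
  apply: le_trans (Ti_le pr) _.
  have -> : opnorm (A - A') * beta / alpha * l2norm x =
    alpha^-1 * (opnorm (A - A') * (beta * l2norm x)) by ring.
  by rewrite ler_wpM2l// invr_ge0.
have {}h : opnorm (A - A') <= 0.
  by move: h; rewrite ler_pdivlMr// -(pmulr_lle0 _ ab) mulrBr subr_le0.
apply/funext => x; apply/eqP; rewrite -subr_eq0; apply/eqP/l2norm_eq0.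
apply/eqP; rewrite eq_le l2norm_ge0 andbT -fun_subE.
by apply: le_trans (opnorm_bound bD x) _; rewrite mulr_le0_ge0// l2norm_ge0.
Qed.

(* The iterates of [coupling_step] from 0 are uniformly bounded with consecutive
   differences tending to 0, so any weak operator cluster point is a fixed point. *)
Lemma coupling_exists : exists A, coupling_op P T A.
Proof.
pose A n := iter n coupling_step (fun=> 0).
have AS n x : A n.+1 x = Ti (A n (T22 x)) - Ti (T12 x) by [].
have bAn n : bounded_op (A n).
  elim: n => [|n IH]; first exact: bounded_zero.
  apply: (@bounded_sub R (Ti \o (A n \o T22)) (Ti \o T12)).
    by do 2 apply: bounded_comp => //.
  by apply: bounded_comp => //; exact: bounded_T12.
have PAn n x : range P (A n x).
  elim: n x => [|n IH] x; first by exists 0 => //; rewrite (lin0 lP).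
  rewrite AS; apply: linear_subspaceB; first exact: subspace_range.
    exact/Ti_range/IH.
  by apply: Ti_range; exists (T (x - P x)).
have AnP n x : A n (P x) = 0.
  by case: n => // n; rewrite AS T22_P T12_P (lin0 (bAn n).1) (lin0 lTi) subrr.
have AnK n x : l2norm (A n x) <= K * l2norm x.
  elim: n x => [|n IH] x; first by rewrite l2norm0 mulr_ge0// l2norm_ge0.
  apply: le_trans (coupling_step_le _ _ _ IH) _ => //.
  by rewrite ler_wpM2r ?l2norm_ge0// ler_pdivrMr// -Kt mulrBr addrC subrK.
have dAn n x : l2norm (A n.+1 x - A n x) <= (beta / alpha) ^+ n * (K * l2norm x).
  elim: n x => [|n IH] x; first by rewrite expr0 mul1r subr0; exact: AnK.
  rewrite [A n.+2 x]AS [A n.+1 x]AS opprB subrKA -(linB lTi).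
  have pr : range P (A n.+1 (T22 x) - A n (T22 x)).
    by apply: linear_subspaceB => //; exact: subspace_range.
  apply: le_trans (Ti_le pr) _.
  have := IH (T22 x); have := T22_le x => h1 h2.
  have h3 : (beta / alpha) ^+ n * (K * l2norm (T22 x)) <=
      (beta / alpha) ^+ n * (K * (beta * l2norm x)).
    by rewrite ler_wpM2l ?exprn_ge0 ?divr_ge0// ler_wpM2l.
  apply: le_trans (_ : _ <= alpha^-1 * ((beta / alpha) ^+ n * (K * (beta * l2norm x)))) _.
    by rewrite ler_pM2l ?invr_gt0//; exact: le_trans h2 h3.
  by rewrite le_eqVlt; apply/orP; left; apply/eqP; rewrite exprS; ring.
have [g [L [gi lL LK hL]]] := wot_compact K0 (fun n => (bAn n).1) AnK.
exists L; apply/coupling_opP; split.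
- by split => //; exists K.
- move=> x; apply: l2_dot_ext => y; rewrite dot0l.
  apply: (tends0_uniq (hL (P x) y)) => e /ltW e0; exists 0%N => n _.
  by rewrite AnP dot0l subrr normc0.
- move=> x; exists (L x) => //; apply: l2_dot_ext => y.
  rewrite (orthproj_sa hP); apply: (tends0_uniq (hL x (P y))).
  apply: tends0_le (hL x y) => n.
  by rewrite -(orthproj_sa hP) (orthproj_range hP).
- move=> x; apply: l2_dot_ext => y; rewrite /coupling_step.
  (* The shifted sequence tends weakly to the step applied to L, by moving [Ti] onto y. It also
     tends to L, since consecutive iterates differ by a geometric term; weak limits are unique. *)
  have h2 : tends0 (fun n => normc (dot (A (g n).+1 x) y -
      dot (Ti (L (T22 x)) - Ti (T12 x)) y)).
    apply: tends0_le (hL (T22 x) (adjoint Ti y)) => n.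
    by rewrite AS -!adjointE// !dotBl opprB addrA subrK.
  apply: (tends0_uniq (a := fun n => dot (A (g n).+1 x) y)) => //.
  have r1 : tends0 (fun n => l2norm y * ((beta / alpha) ^+ (g n) * (K * l2norm x))).
    apply: tends0Z; first exact: l2norm_ge0.
    apply: (@tends0_sub _ (fun n => (beta / alpha) ^+ n * (K * l2norm x))).
      exact: increasing_seq_ge.
    apply: geometric_tends0; first by rewrite divr_ge0.
      by rewrite ltr_pdivrMr// mul1r.
    by rewrite mulr_ge0// l2norm_ge0.
  apply: tends0_le (tends0D r1 (hL x y)) => n.
  have -> : dot (A (g n).+1 x) y - dot (L x) y =
      dot (A (g n).+1 x - A (g n) x) y + (dot (A (g n) x) y - dot (L x) y).
    by rewrite dotBl addrA subrK.
  apply: le_trans (le_normcD _ _) _; rewrite lerD2r.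
  apply: le_trans (cauchy_schwarz _ _) _; rewrite mulrC.
  by rewrite ler_wpM2l ?l2norm_ge0.
Qed.

(** * The subspace S and the oblique projection *)

Section CouplingSpace.
Variable A : l2 R -> l2 R.
Hypothesis hA : coupling_op P T A.
Let S := coupling_space P A.

Let bA : bounded_op A. Proof. by case: hA. Qed.
Let AP x : A (P x) = 0. Proof. by case/coupling_opP: hA. Qed.
Let PA x : P (A x) = A x.
Proof. by case/coupling_opP: hA => _ _ h _; exact: orthproj_range. Qed.

(** Since A vanishes on ran(P) and maps into it, this map is idempotent with range ran(P). *)
Definition coupling_map x := P x - A x.
Definition coupling_map_adj x := P x - adjoint A x.
Local Notation Z := coupling_map.
Local Notation Z' := coupling_map_adj.

Lemma adjA_P x : adjoint A (P x) = adjoint A x.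
Proof.
apply: l2_dot_ext => y; rewrite dotC [RHS]dotC -!adjointE//.
by rewrite -(orthproj_sa hP) PA.
Qed.

Lemma P_adjA x : P (adjoint A x) = 0.
Proof.
by apply: l2_dot_ext => y; rewrite dotC -(orthproj_sa hP) -adjointE// AP !dot0l conjC0.
Qed.

Lemma coupling_map_dot x y : dot (Z x) y = dot x (Z' y).
Proof. by rewrite dotBl dotBr (orthproj_sa hP) adjointE. Qed.

(** Letting x range over the whole space adds nothing, because the adjoint of A factors through
    P. *)
Lemma coupling_spaceP s : S s <-> exists x, s = Z' x.
Proof.
split=> [[_ [x _ <-] <-]|[x ->]]; first by exists x; rewrite adjA_P.
by exists (P x); [exact: orthproj_in_range|rewrite adjA_P].
Qed.

Lemma P_coupling_map_adj x : P (Z' x) = P x.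
Proof. by rewrite (linB lP) (orthproj_idem hP) P_adjA subr0. Qed.

Lemma coupling_map_range x : range P (Z x).
Proof. by exists (Z x) => //; rewrite (linB lP) (orthproj_idem hP) PA. Qed.

(** Applying T to the fixed-point equation gives T A = A T22 - T12, while A T = A T22 because A
    vanishes on T(ran P). The T12 terms of P T and T A match. *)
Lemma coupling_map_comm x : Z (T x) = T (Z x).
Proof.
have /coupling_opP[_ _ _ eA] := hA.
have TA : T (A x) = A (T22 x) - T12 x.
  by rewrite eA /coupling_step (linB lT) !TTi.
have AT : A (T x) = A (T22 x).
  have ATP : A (T (P x)) = 0 by rewrite -PTP AP.
  by rewrite T22E (linB bA.1) AP subr0 (linB lT) (linB bA.1) ATP subr0.
have PT : P (T x) = T (P x) + T12 x.
  by rewrite T12E (linB lT) (linB lP) PTP addrC subrK.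
by rewrite /Z (linB lT) TA AT PT opprB addrA.
Qed.

Lemma coupling_map_iter n x : Z (iter n T x) = iter n T (Z x).
Proof. by elim: n => //= n <-; exact: coupling_map_comm. Qed.

Lemma coupling_space_dim : has_dim S M.
Proof.
apply: (@image_dim _ (range P) M (fun x => x - adjoint A x)) => //.
  have lA := (bounded_adjoint bA).1; move=> a x y.
  by rewrite lA scalerBr opprD addrACA.
move=> x Px /(congr1 P); rewrite (linB lP) (lin0 lP) P_adjA subr0.
by rewrite (orthproj_range hP Px).
Qed.

Lemma coupling_space_invariant : op_invariant (adjoint T) S.
Proof.
move=> _ [_ /coupling_spaceP[x ->] <-]; apply/coupling_spaceP.
exists (adjoint T x); apply: l2_dot_ext => y; rewrite dotC [RHS]dotC.
by rewrite -adjointE// -!coupling_map_dot coupling_map_comm adjointE.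
Qed.

Lemma coupling_space_reducing : op_invariant T (range (idfun - P)) -> S = range P.
Proof.
move=> inv.
(* Invariance of ran(I - P) means T12 = 0, so 0 solves the equation and uniqueness applies. *)
have A0 : A = 0.
  apply: coupling_uniq => //; apply/coupling_opP; split => //.
  - exact: bounded_zero.
  - by move=> x; exists 0 => //; rewrite (lin0 lP).
  - move=> x; have T12x : T12 x = 0.
      have : range (idfun - P) (T (x - P x)) by apply: inv; exists (x - P x) => //; exists x.
      by rewrite T12E => -[z _ <-]; rewrite fun_subE (orthproj_compl hP).
    by rewrite /coupling_step T12x !fun_0E (lin0 lTi) subrr.
have aA : adjoint A = 0.
  by apply: adjoint_uniq => // x y; rewrite A0 !fun_0E dot0l dot0r.
apply/seteqP; split => [_ [x Px <-]|x Px].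
  by rewrite aA fun_0E subr0.
by exists x => //; rewrite aA fun_0E subr0.
Qed.

(** Let s be the projection of y onto S; then Z y = Z s. Writing s = [Z' w] gives |s|^2 = <Z s, P
    w>, and P w = P s has norm at most |s|. *)
Lemma orthproj_coupling_le y : l2norm (orthproj S y) <= l2norm (Z y).
Proof.
have [hE rE] := finite_dim_orthproj coupling_space_dim.
set s := orthproj S y; have Ss : S s by rewrite -rE; exists y.
have lZ : linear Z.
  by move=> a x z; rewrite /Z lP bA.1 scalerBr opprD addrACA.
have Zy : Z y = Z s.
  apply/eqP; rewrite -subr_eq0 -(linB lZ); apply/eqP; apply: l2_dot_ext => w.
  rewrite dot0l coupling_map_dot; apply: (orthproj_orth_range hE).
  by rewrite rE; apply/coupling_spaceP; exists w.
rewrite Zy; have /coupling_spaceP[w sw] := Ss.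
have nw : l2norm (P w) <= l2norm s.
  by rewrite sw -P_coupling_map_adj; exact: orthproj_le.
have h : l2norm s ^+ 2 <= l2norm (Z s) * l2norm (P w).
  have e : dot (Z s) (P w) = (l2norm s ^+ 2)%:C%C.
    rewrite -(orthproj_sa hP) (orthproj_range hP (coupling_map_range s)).
    by rewrite coupling_map_dot -sw dot_sqr.
  have := cauchy_schwarz (Z s) (P w); rewrite e.
  by rewrite (normc_real (sqr_ge0 _)).
have := l2norm_ge0 s; rewrite le_eqVlt => /predU1P[<-|s0]; first exact: l2norm_ge0.
rewrite -(ler_pM2r s0) -expr2; apply: le_trans h _.
by rewrite ler_wpM2l// l2norm_ge0.
Qed.

Lemma coupling_map_le x : l2norm (Z x) <= (1 + t / (alpha - beta)) * l2norm x.
Proof.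
apply: le_trans (l2normD _ _) _; rewrite l2normN mulrDl mul1r.
by apply: lerD; [exact: orthproj_le|exact: coupling_le].
Qed.

(** * Angle estimates and limits of the iteration *)

Section QRIteration.
Variables Q U : nat -> l2 R -> l2 R.
Hypothesis QU : QR_sequences T Q U.
Hypothesis indep : lin_indep (fun j : 'I_M => orthproj S (e_ j)).
Local Notation eM := (initial_span (R := R) M).
Local Notation QM n := (family_span (fun j : 'I_M => Q n (e_ j))).

Let dS : has_dim S M. Proof. exact: coupling_space_dim. Qed.
Let dM : has_dim eM M. Proof. exact: initial_span_dim. Qed.
Let hS : is_orthproj (orthproj S). Proof. by case: (finite_dim_orthproj dS). Qed.
Let hM : is_orthproj (orthproj eM). Proof. by case: (finite_dim_orthproj dM). Qed.
Let rM : range (orthproj eM) = eM. Proof. by case: (finite_dim_orthproj dM). Qed.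
Let PE : orthproj (range P) = P. Proof. exact: orthprojE. Qed.

Lemma gap_lt1 : gap eM S < 1.
Proof.
have [c c0 hc] := indep_lower_bound (orthproj_lin hS) indep.
(* From |y| <= c |P_S y| and Pythagoras. Using c + 1 instead of c keeps the inverse positive and at
   most 1, even if c is 0 or small. *)
pose d := Num.sqrt (1 - ((c + 1)^-1) ^+ 2).
have c1 : 0 < c + 1 by rewrite ltr_wpDl.
have i0 : 0 < (c + 1)^-1 by rewrite invr_gt0.
have i1 : (c + 1)^-1 <= 1 by rewrite invf_le1// lerDr.
have d2 : d ^+ 2 = 1 - ((c + 1)^-1) ^+ 2.
  by rewrite sqr_sqrtr// subr_ge0 expr_le1// ltW.
have d1 : d < 1.
  rewrite -(@ltr_pXn2r _ 2) ?nnegrE ?sqrtr_ge0// d2 expr1n ltrBlDr ltrDl.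
  by rewrite exprn_gt0.
apply: le_lt_trans d1; apply: (gap_le dM dS); first exact: sqrtr_ge0.
move=> y /hc hy.
rewrite -(@ler_pXn2r _ 2) ?nnegrE ?mulr_ge0 ?sqrtr_ge0 ?l2norm_ge0// exprMn d2.
have hy1 : (c + 1)^-1 * l2norm y <= l2norm (orthproj S y).
  rewrite mulrC ler_pdivrMr// mulrC mulrDl mul1r; apply: le_trans hy _.
  by rewrite lerDl l2norm_ge0.
have : ((c + 1)^-1 * l2norm y) ^+ 2 <= l2norm (orthproj S y) ^+ 2.
  by rewrite ler_pXn2r ?nnegrE ?mulr_ge0 ?l2norm_ge0 ?(ltW i0).
rewrite exprMn mulrBl mul1r (orthproj_pyth hS y) => h.
by rewrite lerBrDr addrC lerD2r.
Qed.

Let g := gap eM S.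
Let g0 : 0 <= g. Proof. exact: gap_ge0 dM dS. Qed.
Let g1 : g < 1. Proof. exact: gap_lt1. Qed.
Let gN1 : -1 <= g. Proof. by apply: le_trans g0; rewrite lerN10. Qed.

Lemma angle_lt_pihalf : subspace_angle eM S < pi / 2.
Proof. by apply: asin_ltpi2; rewrite gN1. Qed.

Lemma cos_angle : cos (subspace_angle eM S) = Num.sqrt (1 - g ^+ 2).
Proof. by apply: cos_asin; rewrite gN1 ltW. Qed.

Let cg_gt0 : 0 < Num.sqrt (1 - g ^+ 2).
Proof. by rewrite sqrtr_gt0 subr_gt0 expr_lt1. Qed.

Lemma sin_angle : sin (subspace_angle eM (range P)) = gap eM (range P).
Proof.
apply: asinK; rewrite in_itv /= (gap_le1 dM dP) andbT.
by apply: le_trans (gap_ge0 dM dP); rewrite lerN10.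
Qed.

Lemma cos_angle_le y : eM y ->
  Num.sqrt (1 - g ^+ 2) * l2norm y <= l2norm (orthproj S y).
Proof.
move=> ey; have := gap_dist y dM dS; rewrite (orthproj_range hM) ?rM// -/g => h.
rewrite -(@ler_pXn2r _ 2) ?nnegrE ?mulr_ge0 ?sqrtr_ge0 ?l2norm_ge0// exprMn.
rewrite sqr_sqrtr; last by rewrite subr_ge0 expr_le1// ltW.
have : l2norm (y - orthproj S y) ^+ 2 <= (g * l2norm y) ^+ 2.
  by rewrite ler_pXn2r ?nnegrE ?mulr_ge0 ?l2norm_ge0.
rewrite exprMn mulrBl mul1r {2}(orthproj_pyth hS y) => h2.
by rewrite lerBlDr lerD2l.
Qed.

Lemma compl_iter_le n z :
  l2norm (iter n T z - P (iter n T z)) <= beta ^+ n * l2norm (z - P z).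
Proof.
elim: n => [|n IH]; first by rewrite expr0 mul1r.
set w := iter n T z in IH *.
(* T sends P w back into ran(P), so only the complementary part of w contributes. *)
have -> : iter n.+1 T z - P (iter n.+1 T z) = T22 (w - P w).
  rewrite T22E (orthproj_compl hP) subr0 (linB lT) (linB lP) PTP.
  by rewrite opprB subrKA.
apply: le_trans (T22_le _) _; rewrite exprS -mulrA.
by rewrite ler_wpM2l.
Qed.

Lemma range_iter_le n z : range P z -> alpha ^+ n * l2norm z <= l2norm (iter n T z).
Proof.
move=> Pz; have Pn k : range P (iter k T z).
  by elim: k => //= k IH; exact: T_range.
elim: n => [|n IH]; first by rewrite expr0 mul1r.
apply: le_trans (T_below (Pn n)); rewrite exprS -mulrA.
by rewrite ler_wpM2l.
Qed.

Lemma gap_QM_le n : gap (QM n) (range P) <=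
  gap eM (range P) / Num.sqrt (1 - g ^+ 2) * (beta ^+ n / alpha ^+ n) *
    (1 + t / (alpha - beta)).
Proof.
have an : 0 < alpha ^+ n by rewrite exprn_gt0.
have b0 : 0 <= 1 + t / (alpha - beta) by rewrite addr_ge0.
apply: (gap_le (Q_span_dim QU n M) dP).
  by rewrite !mulr_ge0 ?invr_ge0 ?exprn_ge0 ?(gap_ge0 dM dP) ?(ltW cg_gt0)// ltW.
move=> x /(Q_span_iter bTi TiT QU)[y ey ->]; rewrite PE.
set s := gap eM (range P).
have hy : l2norm (y - P y) <= s * l2norm y.
  by have := gap_dist y dM dP; rewrite (orthproj_range hM) ?rM// PE.
have s0 : 0 <= s := gap_ge0 dM dP.
set c := Num.sqrt _; have c0 : 0 < c := cg_gt0.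
have h1 : l2norm y <=
    c^-1 * ((alpha ^+ n)^-1 * ((1 + t / (alpha - beta)) * l2norm (iter n T y))).
  rewrite ler_pdivlMl//; apply: le_trans (cos_angle_le ey) _.
  apply: le_trans (orthproj_coupling_le _) _; rewrite ler_pdivlMl//.
  apply: le_trans (range_iter_le n (coupling_map_range _)) _.
  by rewrite -coupling_map_iter; exact: coupling_map_le.
apply: le_trans (compl_iter_le n y) _.
apply: le_trans (_ : _ <= beta ^+ n * (s * l2norm y)) _.
  by rewrite ler_wpM2l ?exprn_ge0.
have := ler_wpM2l (mulr_ge0 (exprn_ge0 n beta_ge0) s0) h1.
rewrite mulrA => h; apply: le_trans h _.
by rewrite le_eqVlt; apply/orP; left; apply/eqP; ring.
Qed.

Lemma gap_QM_tends0 : tends0 (fun n => gap (QM n) (range P)).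
Proof.
pose C := gap eM (range P) / Num.sqrt (1 - g ^+ 2) * (1 + t / (alpha - beta)).
apply: (@tends0_le _ _ (fun n => (beta / alpha) ^+ n * C)).
  move=> n; apply: le_trans (gap_QM_le n) _; rewrite /C expr_div_n.
  by rewrite le_eqVlt; apply/orP; left; apply/eqP; ring.
apply: geometric_tends0; first by rewrite divr_ge0.
  by rewrite ltr_pdivrMr// mul1r.
by rewrite mulr_ge0 ?addr_ge0// mulr_ge0 ?invr_ge0 ?(gap_ge0 dM dP).
Qed.

Local Notation TQ := (conj_iterate T Q).

(** With a = Q_n e_j and b = Q_n e_i, split T a into T (a - P a) and T P a. The latter lies in
    ran(P) and pairs only with P b. Both a - P a and P b are at most the gap, as a lies in the span
    and b is orthogonal to it. *)
Lemma lower_left_le n i j : (j < M)%N -> (M <= i)%N ->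
  normc (dot (TQ n (e_ j)) (e_ i)) <= (opnorm T + opnorm T) * gap (QM n) (range P).
Proof.
move=> jM Mi; have uQ := Q_unitary QU n; have [bQ _ _] := uQ.
have dQ := Q_span_dim QU n M.
have [hQ rQ] := finite_dim_orthproj dQ.
set a := Q n (e_ j); set b := Q n (e_ i); set d := gap (QM n) (range P).
have d0 : 0 <= d by exact: gap_ge0 dQ dP.
have a1 : l2norm a = 1 by rewrite /a unitary_norm// l2norm_e.
have b1 : l2norm b = 1 by rewrite /b unitary_norm// l2norm_e.
have T0 : 0 <= opnorm T by exact: opnorm_ge0.
have Qa : orthproj (QM n) a = a.
  apply: (orthproj_range hQ); rewrite rQ.
  exact: (span_mem (fun j : 'I_M => Q n (e_ j)) (Ordinal jM)).
have Qb : orthproj (QM n) b = 0.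
  apply: dot_eq0; rewrite (orthproj_sa hQ) (orthproj_idem hQ).
  have : range (orthproj (QM n)) (orthproj (QM n) b) by exact: orthproj_in_range.
  rewrite {1}rQ => /spanP[c ->]; rewrite dot_sumr big1// => k _.
  rewrite dotZr unitary_dot// dot_ee ltn_eqF ?mulr0//.
  exact: leq_trans (ltn_ord k) Mi.
have ha : l2norm (a - P a) <= d.
  by have := gap_dist a dQ dP; rewrite Qa PE a1 mulr1.
have hb : l2norm (P b) <= d.
  by have := gap_dist b dQ dP; rewrite Qb PE b1 mulr1 sub0r l2normN.
have -> : dot (TQ n (e_ j)) (e_ i) = dot (T (a - P a)) b + dot (T (P a)) (P b).
  rewrite -(orthproj_sa hP) PTP -dotDl -(linD lT) subrK.
  by rewrite /conj_iterate /= -adjointEr//; exact: bounded_adjoint.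
apply: le_trans (le_normcD _ _) _; rewrite mulrDl; apply: lerD.
  apply: le_trans (cauchy_schwarz _ _) _; rewrite b1 mulr1.
  by apply: le_trans (opnorm_bound bT _) _; rewrite ler_wpM2l.
apply: le_trans (cauchy_schwarz _ _) _; apply: ler_pM; rewrite ?l2norm_ge0//.
apply: le_trans (opnorm_bound bT _) _; rewrite -[leRHS]mulr1 ler_wpM2l// -a1.
exact: orthproj_le.
Qed.

(** The norm bound on L is kept because the upgrade to strong convergence, along the same
    subsequence and with the same limit, uses it. *)
Lemma conj_iterate_subsequence (f : nat -> nat) : increasing_seq f ->
  exists h L, [/\ increasing_seq h, bounded_op L /\ block_form M L,
    forall x, l2norm (L x) <= opnorm T * l2norm x &
    forall x y, tends0 (fun k => normc (dot (TQ (f (h k)) x) y - dot (L x) y))].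
Proof.
move=> fi; have T0 : 0 <= opnorm T by exact: opnorm_ge0.
have lTQ n : linear (TQ n) by case: (conj_iterate_bounded bT QU n).
have [h [L [hi lL LT hL]]] := wot_compact T0 (fun n => lTQ (f n))
  (fun n x => conj_iterate_le bT QU (f n) x).
have bL : bounded_op L by split => //; exists (opnorm T).
exists h, L; split => //; split => //.
apply: block_form_of_columns => // j jM; apply/initial_spanP => i Mi.
rewrite -dot_e; apply: (tends0_uniq (hL (e_ j) (e_ i))).
have gs : tends0 (fun k => gap (QM (f (h k))) (range P)).
  apply: (@tends0_sub _ (fun n => gap (QM n) (range P)) (f \o h)).
    move=> n; apply: leq_trans (increasing_seq_ge hi n) _.
    exact: increasing_seq_ge.
  exact: gap_QM_tends0.
apply: tends0_le (tends0Z (addr_ge0 T0 T0) gs) => n.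
by rewrite subr0; exact: lower_left_le.
Qed.

End QRIteration.

End CouplingSpace.

End Coupling.

Theorem theorem3p15 (R : realType) (T P : l2 R -> l2 R) (M : nat)
    (alpha beta : R)
    (T_bounded : bounded_op T) (T_invertible : invertible_op T)
    (P_proj : is_orthproj P) (P_rank : has_dim (range P) M)
    (P_inv : op_invariant T (range P))
    (beta_gt0 : 0 < beta) (beta_lt_alpha : beta < alpha)
    (T_below : forall x, range P x -> alpha * l2norm x <= l2norm (T x))
    (T_above : opnorm ((idfun - P) \o T \o (idfun - P)) <= beta) :
  (exists! A, coupling_op P T A) /\
  forall A, coupling_op P T A ->
  let S := coupling_space P A in
  [/\ has_dim S M, op_invariant (adjoint T) S
    & op_invariant T (range (idfun - P)) -> S = range P] /\
  (lin_indep (fun j : 'I_M => orthproj S (e_ j)) ->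
   forall Q U : nat -> l2 R -> l2 R, QR_sequences T Q U ->
   let eM := family_span (fun j : 'I_M => e_ j : l2 R) in
   let TQ n := adjoint (Q n) \o T \o Q n in
   [/\ subspace_angle eM S < pi / 2 /\
       (forall n : nat,
          gap (family_span (fun j : 'I_M => Q n (e_ j))) (range P) <=
          sin (subspace_angle eM (range P)) / cos (subspace_angle eM S)
          * (beta ^+ n / alpha ^+ n)
          * (1 + opnorm (P \o T \o (idfun - P)) / (alpha - beta))),
       (forall f : nat -> nat, increasing_seq f ->
          exists (g : nat -> nat) (L : l2 R -> l2 R),
            [/\ increasing_seq g, block_form M L &
                wot_cvg (fun k => TQ (f (g k))) L])
     & (finite_columns T ->
        forall f : nat -> nat, increasing_seq f ->
          exists (g : nat -> nat) (L : l2 R -> l2 R),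
            [/\ increasing_seq g, block_form M L &
                sot_cvg (fun k => TQ (f (g k))) L])]).
Proof.
have [Ti [bTi TiT0 TTi0]] := T_invertible.
have TiT x : Ti (T x) = x by rewrite -[LHS]/((Ti \o T) x) TiT0.
have TTi x : T (Ti x) = x by rewrite -[LHS]/((T \o Ti) x) TTi0.
split.
  have [A hA] := coupling_exists T_bounded bTi TiT TTi P_proj P_rank P_inv
    beta_gt0 beta_lt_alpha T_below T_above.
  exists A; split => // A' hA'.
  exact: (coupling_uniq T_bounded bTi TiT TTi P_proj P_rank P_inv
    beta_gt0 beta_lt_alpha T_below T_above hA hA').
move=> A hA S; split; first split.
- exact: (coupling_space_dim T_bounded bTi TiT TTi P_proj P_rank P_inv hA).
- exact: (coupling_space_invariant T_bounded bTi TiT TTi P_proj P_rank P_inv hA).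
- exact: (coupling_space_reducing T_bounded bTi TiT TTi P_proj P_rank P_inv
    beta_gt0 beta_lt_alpha T_below T_above hA).
move=> indep Q U QU eM TQ.
have sub := conj_iterate_subsequence T_bounded bTi TiT TTi P_proj P_rank P_inv
    beta_gt0 beta_lt_alpha T_below T_above hA QU indep.
split; first split.
- exact: (angle_lt_pihalf T_bounded bTi TiT TTi P_proj P_rank P_inv hA indep).
- move=> n; rewrite (sin_angle P_rank).
  rewrite (cos_angle T_bounded bTi TiT TTi P_proj P_rank P_inv hA indep).
  exact: (gap_QM_le T_bounded bTi TiT TTi P_proj P_rank P_inv
    beta_gt0 beta_lt_alpha T_below T_above hA QU indep).
- move=> f /sub[g [L [gi [bL bfL] _ hL]]]; exists g, L; split => // x y.
  by apply: tends0_cvg (hL x y) => n; exact: normc_ge0.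
move=> fT f /sub[g [L [gi [bL bfL] LT hL]]]; exists g, L; split => // x.
apply: tends0_cvg => [n|]; first exact: l2norm_ge0.
apply: (strong_of_weak (opnorm_ge0 T_bounded) _ bL.1 _ LT hL) => [n|n y|j].
- by case: (conj_iterate_bounded T_bounded QU (f (g n))).
- exact: (conj_iterate_le T_bounded QU).
(* [e_ j] is counted from 0 and first appears in the initial span of dimension j.+1. *)
- have [N hN] := conj_iterate_columns T_bounded bTi TiT QU j.+1 fT.
  by exists N => n; apply: hN; exact: initial_span_e.
Qed.
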